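(* Suppose there is a language $L \in \mathrm{NP}$ and a constant $\epsilon > 0$ such that for all but finitely many $n$, $CC(L_n) > 2^{n^{\epsilon}}$. Then every $\mathrm{NP}$-complete language $A$ is complete for $\mathrm{NP}$ via length-increasing $\mathrm{P/poly}$ reductions; that is, for every $B \in \mathrm{NP}$ there is a function $f$ computable by a polynomial-size circuit family (equivalently, in polynomial time with polynomial-length advice depending only on the input length) such that for all $x$, $x \in B \iff f(x) \in A$, and $|f(x)| > |x|$.
   Context: Languages are over $\Sigma=\{0,1\}$. For a language $L$, $L_n$ denotes the Boolean function $\Sigma^n \to \Sigma$ given by the characteristic function of $L$ restricted to strings of length $n$. For a Boolean function $g:\Sigma^n\to\Sigma$, $CC(g)$ is the smallest $s$ such that some Boolean circuit of size $s$ computes $g$. ''$\mathrm{NP}$-complete'' means complete under polynomial-time many-one reductions. *)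

(* Defs.v *)
From mathcomp Require Import all_boot.
From Stdlib Require Import Reals.

Set Implicit Arguments.
Unset Strict Implicit.
Unset Printing Implicit Defensive.

Definition language := seq bool -> Prop.

(** * Deterministic single-tape Turing machines
    Tape alphabet: [Some b] for a bit b, [None] for the blank.
    The tape is two-way infinite; finitely many states ['I_Q.+1]. *)
Definition sym := option bool.
Inductive move := MoveL | MoveR | Stay.

Record TM := {
  tm_Q : nat;
  tm_delta : 'I_tm_Q.+1 -> sym -> 'I_tm_Q.+1 * sym * move;
  tm_start : 'I_tm_Q.+1;
  tm_acc : 'I_tm_Q.+1;
  tm_rej : 'I_tm_Q.+1 }.

(* configuration: state, tape left of the head (nearest cell first),
   scanned symbol, tape right of the head *)
Definition config (M : TM) := ('I_(tm_Q M).+1 * seq sym * sym * seq sym)%type.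

Definition halted (M : TM) (q : 'I_(tm_Q M).+1) : bool :=
  (q == tm_acc M) || (q == tm_rej M).

Definition step (M : TM) (c : config M) : config M :=
  let: (q, l, h, r) := c in
  if halted q then c else
  let: (q', w, m) := tm_delta q h in
  match m with
  | Stay => (q', l, w, r)
  | MoveL => match l with
             | [::] => (q', [::], None, w :: r)
             | a :: l' => (q', l', a, w :: r)
             end
  | MoveR => match r with
             | [::] => (q', w :: l, None, [::])
             | a :: r' => (q', w :: l, a, r')
             end
  end.

Definition init (M : TM) (inp : seq sym) : config M :=
  (tm_start M, [::], head None inp, behead inp).

Definition run (M : TM) (t : nat) (inp : seq sym) : config M :=
  iter t (@step M) (init M inp).

Definition cstate (M : TM) (c : config M) : 'I_(tm_Q M).+1 :=
  let: (q, _, _, _) := c in q.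

Fixpoint read_bits (s : seq sym) : seq bool :=
  match s with
  | Some b :: s' => b :: read_bits s'
  | _ => [::]
  end.

Definition coutput (M : TM) (c : config M) : seq bool :=
  let: (_, _, h, r) := c in read_bits (h :: r).

Definition encode (x : seq bool) : seq sym := map Some x.
Definition encode_pair (x w : seq bool) : seq sym :=
  map Some x ++ None :: map Some w.

Definition pbound (c k n : nat) : nat := c * n ^ k + c.

Definition in_NP (L : language) : Prop :=
  exists (M : TM) (c k : nat), forall x : seq bool,
    L x <-> exists w : seq bool, size w <= pbound c k (size x) /\
      cstate (run M (pbound c k (size x)) (encode_pair x w)) = tm_acc M.

Definition poly_time_computable (f : seq bool -> seq bool) : Prop :=
  exists (M : TM) (c k : nat), forall x : seq bool,
    let cf := run M (pbound c k (size x)) (encode x) in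
    halted (cstate cf) /\ coutput cf = f x.

Definition pm_reducible (B A : language) : Prop :=
  exists f, poly_time_computable f /\ forall x, B x <-> A (f x).

Definition NP_complete (A : language) : Prop :=
  in_NP A /\ forall B, in_NP B -> pm_reducible B A.

Definition ppoly_computable (f : seq bool -> seq bool) : Prop :=
  exists (M : TM) (c k : nat) (adv : nat -> seq bool),
    (forall n, size (adv n) <= pbound c k n) /\
    forall x : seq bool,
      let cf := run M (pbound c k (size x)) (encode_pair x (adv (size x))) in
      halted (cstate cf) /\ coutput cf = f x.

(** * Boolean circuits (fan-in <= 2 AND/OR, NOT), as straight-line programs.
    Wires 0..n-1 are the inputs, wire n+i is the output of gate i; a gate may
    only read already computed wires (other references read [false]).
    The size of a circuit is its number of gates. *)
Inductive gate := GNot of nat | GAnd of nat & nat | GOr of nat & nat.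

Record circuit := { c_gates : seq gate; c_out : nat }.

Definition gate_val (vals : seq bool) (g : gate) : bool :=
  match g with
  | GNot j => ~~ nth false vals j
  | GAnd j k => nth false vals j && nth false vals k
  | GOr j k => nth false vals j || nth false vals k
  end.

Definition circ_eval (C : circuit) (x : seq bool) : bool :=
  nth false (foldl (fun vals g => rcons vals (gate_val vals g)) x (c_gates C))
      (c_out C).

Definition circ_size (C : circuit) : nat := size (c_gates C).

Definition computes_Ln (C : circuit) (L : language) (n : nat) : Prop :=
  forall x : seq bool, size x = n -> (circ_eval C x = true <-> L x).

Definition CC_gt (L : language) (n : nat) (s : R) : Prop :=
  forall C, computes_Ln C L n -> (s < INR (circ_size C))%R.

(* Main.v *)
Require Import Defs.
From mathcomp Require Import all_boot.
From Stdlib Require Import Reals.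
From HB Require Import structures.
From mathcomp Require Import zify.
From Stdlib Require Import FunctionalExtensionality ClassicalEpsilon Lra.

(** For strings x, y of a length m polynomial in n = |z|, consider the NP property
    "y is in L, or both x is in L and z is in B", and let f reduce it to A.  If x is in L and y is
    not, then z is in B iff f (x, y, z) is in A, so it suffices to find, for each n, one such pair
    for which |f (x, y, z)| > n for every z of length n; the pair is the advice.

    Suppose every pair has a z with |f (x, y, z)| <= n.  If z is not in B, then f (x, y, z) is a
    short non-member of A, which certifies that y is not in L.  If z is in B, then f (x, y, z) is a
    short member of A, which certifies (given that y is not in L) that x is in L.  So each pair
    carries a certificate for x or one for y, and by a minimax argument either about m strings x
    certify all y outside L, or about m strings y certify all x in L.  Since there are only
    2^(n+1) short strings, their membership in A can be tabulated, and L has circuits of size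
    2^(2n) poly(n) at length m, contradicting its hardness once m^eps >= n^2.

    The property is in NP by means of an explicit verifier: a string is read as a sequence of
    blocks of 44 cells, the j-th cells of all blocks forming a stack, and three simulations with
    clocks are run on these stacks. *)

Set Implicit Arguments.
Unset Strict Implicit.
Unset Printing Implicit Defensive.

(** * Turing machines on function tapes *)

(** The verifier is one fixed machine without arithmetic, so the time bounds for [L] and [B] are
    part of the instance, written in unary as clocks. The number 44 comes from three simulations
    with seven tracks each: they occupy the odd cells up to 41 of a block, and cells 0 and 43 are
    borders. The even cells are left free for the reduction. Advice may depend on the length of [z]
    only, while the reduction to [A] needs a complete instance; the advice is therefore the instance
    with gaps for the bits of [z], each gap announced by a 1 in the even cell before it. A machine
    fills the gaps and then runs the reduction in place. The hardness of [L] holds for long strings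
    only. All lengths are computed from [n] plus a constant, so that small [n] need no separate
    treatment. *)

Definition upd (f : nat -> sym) (p : nat) (w : sym) : nat -> sym :=
  fun i => if i == p then w else f i.

(** Positions are naturals, so a left move at 0 stays there. Whenever such a run is compared with a
    list tape, the head starts at a position not below the number of steps, and the case does not
    matter. *)
Definition shift_head (m : move) (p : nat) : nat :=
  match m with MoveL => p.-1 | MoveR => p.+1 | Stay => p end.

Section FunctionTape.
Variables (Q : eqType) (d : Q -> sym -> Q * sym * move) (ac re : Q).

Definition fstep (c : Q * (nat -> sym) * nat) : Q * (nat -> sym) * nat :=
  let: (q, f, p) := c in
  if (q == ac) || (q == re) then c else
  let: (q', w, m) := d q (f p) in (q', upd f p w, shift_head m p).

Lemma fstep_halted c : (c.1.1 == ac) || (c.1.1 == re) -> fstep c = c.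
Proof. by case: c => [[q f] p] /= ->. Qed.

Lemma iter_fstep_halted t c :
  (c.1.1 == ac) || (c.1.1 == re) -> iter t fstep c = c.
Proof. by move=> h; elim: t => //= t ->; apply: fstep_halted. Qed.

Lemma iter_fstep_halted_le t t' c : t <= t' ->
  ((iter t fstep c).1.1 == ac) || ((iter t fstep c).1.1 == re) ->
  iter t' fstep c = iter t fstep c.
Proof.
by move=> le h; rewrite -(subnK le) iterD iter_fstep_halted.
Qed.

Lemma fstep_head c : (fstep c).2 <= c.2.+1 /\ c.2 <= (fstep c).2.+1.
Proof.
case: c => [[q f] p] /=; case: ifP => _ /=; first by split.
by case: (d q (f p)) => [[q' w] []] /=; split; lia.
Qed.

Lemma iter_fstep_head t c :
  (iter t fstep c).2 <= c.2 + t /\ c.2 <= (iter t fstep c).2 + t.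
Proof.
elim: t => [|t [h1 h2]]; first by rewrite addn0.
by rewrite iterS; have [] := fstep_head (iter t fstep c); lia.
Qed.

(** In [t] steps the head reads no cell beyond [p + t]. This later allows certificates to be cut to
    the running time. *)
Lemma iter_fstep_agree t q f g p :
  (forall i, i <= p + t -> f i = g i) ->
  (iter t fstep (q, f, p)).1.1 = (iter t fstep (q, g, p)).1.1.
Proof.
elim: t q f g p => [//|t IH] q f g p fg.
rewrite !iterSr /=; case: ifP => hq.
  by rewrite !iter_fstep_halted.
rewrite fg; last lia.
case: (d q (g p)) => [[q' w] m]; apply: IH => i hi.
rewrite /upd; case: eqP => // _; apply: fg.
by move: hi; case: m => /=; lia.
Qed.

End FunctionTape.

(** * List tapes and function tapes *)

Section Representation.
Variable M : TM.

Definition mstep := fstep (@tm_delta M) (tm_acc M) (tm_rej M).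

(** [nth None] identifies absent list cells with blank ones. Left of position 0 the list tape has to
    be blank. *)
Definition rep (c : config M) (fc : 'I_(tm_Q M).+1 * (nat -> sym) * nat) : Prop :=
  let: (q, l, h, r) := c in let: (q', f, p) := fc in
  [/\ q = q', forall k, nth None l k = if k < p then f (p - k.+1) else None,
      h = f p & forall k, nth None r k = f (p + k.+1)].

Lemma rep_step c fc : rep c fc -> 0 < fc.2 -> rep (step c) (mstep fc).
Proof.
case: c => [[[q l] h] r]; case: fc => [[q' f] p] /= [-> hl -> hr] p0.
rewrite /halted; case: ifP => _; first by [].
case: (tm_delta q' (f p)) => [[q2 w] []] /=.
- have E k : (k < p.-1) = (k.+1 < p) by lia.
  have up i : i != p -> upd f p w i = f i by rewrite /upd => /negbTE ->.
  have hr' k : nth None (w :: r) k = upd f p w (p.-1 + k.+1).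
    case: k => [|k] /=; first by rewrite /upd; case: eqP => //; lia.
    by rewrite hr up; [congr f; lia | lia].
  case: l hl => [|a l] hl; split => //.
  + move=> k; rewrite nth_nil E; have := hl k.+1; rewrite nth_nil.
    by case: ifP => // kp ->; rewrite up; [congr f; lia | lia].
  + by have := hl 0; rewrite p0 /= => ->; rewrite up; [congr f; lia | lia].
  + move=> k; rewrite E; have := hl k.+1 => /= ->.
    by case: ifP => // kp; rewrite up; [congr f; lia | lia].
  + by have := hl 0; rewrite p0 /= => ->; rewrite up; [congr f; lia | lia].
- have hl' k : nth None (w :: l) k = if k < p.+1 then upd f p w (p.+1 - k.+1) else None.
    case: k => [|k] /=; rewrite /upd; first by case: eqP => //; lia.
    by rewrite hl ltnS; case: ifP => // kp; case: eqP; [lia | move=> _; congr f; lia].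
  case: r hr => [|a r] hr; split => //.
  + by have := hr 0; rewrite /= /upd => ->; case: eqP; [lia | move=> _; congr f; lia].
  + move=> k; rewrite nth_nil /upd; have := hr k.+1; rewrite nth_nil => ->.
    by case: eqP; [lia | move=> _; congr f; lia].
  + by have := hr 0; rewrite /= /upd => ->; case: eqP; [lia | move=> _; congr f; lia].
  + move=> k; rewrite /upd; have := hr k.+1 => /= ->.
    by case: eqP; [lia | move=> _; congr f; lia].
- split=> // [k||k]; rewrite /upd.
  + by rewrite hl; case: ifP => // kp; case: eqP; [lia | done].
  + by rewrite eqxx.
  + by rewrite hr; case: eqP; [lia | done].
Qed.

Lemma rep_iter t c fc : rep c fc -> t <= fc.2 -> rep (iter t (@step M) c) (iter t mstep fc).
Proof.
move=> h; elim: t => [//|t IH] le /=.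
apply: rep_step; first by apply: IH; lia.
have [_] := iter_fstep_head (@tm_delta M) (tm_acc M) (tm_rej M) t fc.
by rewrite -/mstep => hh; rewrite -(ltn_add2r t); apply: leq_trans hh.
Qed.

Definition tape_at (D : nat) (s : seq sym) : nat -> sym :=
  fun i => if i < D then None else nth None s (i - D).

Lemma rep_init D s : rep (init M s) (tm_start M, tape_at D s, D).
Proof.
split => //; rewrite /tape_at.
- by move=> k; rewrite nth_nil; case: ifP => // kD; case: ifP => //; lia.
- by rewrite ltnn subnn nth0.
- move=> k; rewrite nth_behead; case: ifP; first lia.
  by move=> _; congr nth; lia.
Qed.

Lemma run_rep t D s : t <= D ->
  rep (run M t s) (iter t mstep (tm_start M, tape_at D s, D)).
Proof. by move=> le; apply: rep_iter => //; apply: rep_init. Qed.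

Lemma rep_state c fc : rep c fc -> cstate c = fc.1.1.
Proof. by case: c => [[[q l] h] r]; case: fc => [[q' f] p] [-> _ _ _]. Qed.

Lemma run_state t D s : t <= D ->
  cstate (run M t s) = (iter t mstep (tm_start M, tape_at D s, D)).1.1.
Proof. by move=> le; apply: rep_state; apply: run_rep. Qed.

End Representation.

Lemma read_bits_ext s1 s2 :
  (forall k, nth None s1 k = nth None s2 k) -> read_bits s1 = read_bits s2.
Proof.
elim: s1 s2 => [|a s1 IH] [|b s2] h //=.
- by have := h 0 => /= <-.
- by have := h 0 => /= ->.
- have := h 0 => /= ->; case: b h => // b h; congr (_ :: _).
  by apply: IH => k; have := h k.+1.
Qed.

Lemma rep_output (M1 M2 : TM) (c1 : config M1) (c2 : config M2) q1 q2 f p :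
  rep c1 (q1, f, p) -> rep c2 (q2, f, p) -> coutput c1 = coutput c2.
Proof.
case: c1 => [[[q l] h] r]; case: c2 => [[[q' l'] h'] r'] [_ _ e1 e2] [_ _ e3 e4].
apply: read_bits_ext => -[|k] /=; first by rewrite e1 e3.
by rewrite e2 e4.
Qed.

(** Equality of outputs is split into tests of single cells because circuits will evaluate it; the
    last test is for the blank that stops [read_bits]. *)
Lemma output_nth (M : TM) (c : config M) q f p a :
  rep c (q, f, p) ->
  (coutput c == a) = all (fun k => f (p + k) == Some (nth false a k)) (iota 0 (size a))
     && (f (p + size a) == None).
Proof.
case: c => [[[q' l] h] r] [_ _ e1 e2].
have : forall k, nth None (h :: r) k = f (p + k).
  by case=> [|k]; rewrite ?addn0 //= e2 addnS.
rewrite /coutput; move: (h :: r) => {e1 e2 h r l} s.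
elim: a s p => [|b a IH] s p e /=.
  rewrite addn0; have := e 0; rewrite addn0 => <-.
  by case: s {e} => [|[b|] s].
have := e 0; rewrite addn0 => <-.
have e' k : nth None (behead s) k = f (p.+1 + k).
  by rewrite nth_behead e addSnnS.
rewrite -addSnnS (iotaDl 1 0) all_map.
rewrite (eq_all (a2 := fun k => f (p.+1 + k) == Some (nth false a k))); last first.
  by move=> k /=; rewrite add1n addnS addSn.
case: s e e' => [|[c|] s] e e' //=.
rewrite eqseq_cons (IH s p.+1) //.
by rewrite -andbA; congr andb.
Qed.

(** * Machines with an arbitrary finite type of states *)

Section FiniteStates.
Variables (Q : finType) (d : Q -> sym -> Q * sym * move) (st ac re : Q).

Definition enc (q : Q) : 'I_(#|Q|.-1).+1 := inord (enum_rank q).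
Definition dec (i : 'I_(#|Q|.-1).+1) : Q := nth st (enum Q) i.

Lemma decK : cancel enc dec.
Proof.
move=> q; rewrite /dec /enc inordK.
  exact: nth_enum_rank.
by rewrite prednK; [exact: ltn_ord | exact: leq_ltn_trans (ltn_ord (enum_rank q))].
Qed.

Definition mkTM : TM :=
  {| tm_Q := #|Q|.-1;
     tm_delta := fun i a => let: (q, w, m) := d (dec i) a in (enc q, w, m);
     tm_start := enc st; tm_acc := enc ac; tm_rej := enc re |}.

Lemma mkTM_iter t q f p :
  let: (q', f', p') := iter t (fstep d ac re) (q, f, p) in
  iter t (@mstep mkTM) (enc q, f, p) = (enc q', f', p').
Proof.
elim: t => [//|t]; rewrite !iterS.
case: (iter t _ (q, f, p)) => [[q' f'] p'] ->.
rewrite /mstep /= !(can_eq decK); case: ifP => _ //.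
by rewrite decK; case: (d q' (f' p')) => [[? ?] ?].
Qed.

End FiniteStates.

(** * Machines with several stacks on one tape *)

Inductive op :=
  OId | OIns of sym | ORep of sym | ORepIns of sym & sym | OConst of sym | OPop of sym.

Definition op_code (o : op) : 'I_6 * sym * sym :=
  match o with
  | OId => (inord 0, None, None) | OIns a => (inord 1, a, None)
  | ORep a => (inord 2, a, None) | ORepIns a b => (inord 3, a, b)
  | OConst a => (inord 4, a, None) | OPop a => (inord 5, a, None)
  end.

Definition op_decode (x : 'I_6 * sym * sym) : op :=
  let: (t, a, b) := x in
  match val t with
  | 0 => OId | 1 => OIns a | 2 => ORep a | 3 => ORepIns a b | 4 => OConst a | _ => OPop a
  end.

Lemma op_codeK : cancel op_code op_decode.
Proof. by case=> *; rewrite /op_decode /= inordK. Qed.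

HB.instance Definition _ := Equality.copy op (can_type op_codeK).
HB.instance Definition _ := Choice.copy op (can_type op_codeK).
HB.instance Definition _ := Countable.copy op (can_type op_codeK).
HB.instance Definition _ := Finite.copy op (can_type op_codeK).

Definition is_pop (o : op) : bool := if o is OPop _ then true else false.

(** The operation of a stack is also the memory of the sweep that performs it: an insertion carries
    the symbol that it has just displaced to the next block on the right, a deletion carries the
    symbol just read to the next block on the left. *)
Definition right_step (o : op) (h : sym) : op * sym :=
  match o with
  | OId => (OId, h) | OIns a => (OIns h, a) | ORep a => (OId, a)
  | ORepIns a b => (OIns b, a) | OConst a => (OConst a, a) | OPop a => (OPop a, h)
  end.

Definition left_step (o : op) (h : sym) : op * sym :=
  if o is OPop a then (OPop h, a) else (o, h).

Definition op_effect (o : op) (v : nat -> sym) (i : nat) : sym :=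
  match o with
  | OId => v i
  | OIns a => if i is i'.+1 then v i' else a
  | ORep a => if i is _.+1 then v i else a
  | ORepIns a b => match i with 0 => a | 1 => b | i'.+1 => v i' end
  | OConst a => a
  | OPop _ => v i.+1
  end.

Fixpoint right_op (o : op) (v : nat -> sym) (i : nat) : op :=
  if i is i'.+1 then (right_step (right_op o v i') (v i')).1 else o.

Definition right_out (o : op) (v : nat -> sym) (i : nat) : sym := (right_step (right_op o v i) (v i)).2.

Definition left_out (o : op) (v : nat -> sym) (i : nat) : sym :=
  if is_pop o then v i.+1 else v i.

Lemma right_op_pop o v i : is_pop o -> right_op o v i = o.
Proof. by case: o => // a _; elim: i => //= i ->. Qed.

Lemma right_op_const a v i : right_op (OConst a) v i = OConst a.
Proof. by elim: i => //= i ->. Qed.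

Lemma is_pop_right_op o v i : is_pop (right_op o v i) = is_pop o.
Proof. by elim: i => //= i <-; case: (right_op o v i). Qed.

Lemma right_out_const a v i : right_out (OConst a) v i = a.
Proof. by rewrite /right_out right_op_const. Qed.

Lemma right_out_effect o v i : ~~ is_pop o -> right_out o v i = op_effect o v i.
Proof.
case: o => // [|a|a|a b|a] _; last by rewrite right_out_const.
- by rewrite /right_out (_ : right_op _ _ _ = OId) //; elim: i => //= i ->.
- by rewrite /right_out (_ : right_op _ _ _ = OIns (if i is i'.+1 then v i' else a)) //; elim: i => //= i ->.
- by rewrite /right_out (_ : right_op _ _ _ = if i is i'.+1 then OId else ORep a); [case: i | elim: i => //= -[|i] ->].
- rewrite /right_out (_ : right_op _ _ _ = match i with 0 => ORepIns a b | 1 => OIns b | i'.+1 => OIns (v i') end).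
    by case: i => [|[|i]].
  by elim: i => //= -[|[|i]] ->.
Qed.

Lemma right_out_pop o v i : is_pop o -> right_out o v i = v i.
Proof. by move=> h; rewrite /right_out right_op_pop //; case: o h. Qed.

Lemma dvdn_succ c' y : (c'.+1 %| y.+1) = (y %% c'.+1 == c').
Proof.
rewrite {1}(divn_eq y c'.+1) -addnS dvdn_addr ?dvdn_mull //.
have h := ltn_pmod y (ltn0Sn c'); case: eqP => [->|ne]; first exact: dvdnn.
by rewrite gtnNdvd // ltnS; move: h ne; rewrite leq_eqVlt => /orP[/eqP[]|].
Qed.

Section StackMachine.
Variables (c' : nat) (Q : finType).
Notation c := c'.+1.
(** [None] stands for acceptance. Rejection is not modelled: a run that does not accept goes on
    forever. *)
Variable dl : Q -> {ffun 'I_c -> sym} -> option (Q * {ffun 'I_c -> op}).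
Variables (q0 : Q) (o0 : {ffun 'I_c -> op}).

Definition fupd {T : Type} (g : {ffun 'I_c -> T}) (j : 'I_c) (x : T) : {ffun 'I_c -> T} :=
  [ffun k => if k == j then x else g k].

(** A left pass writes the symbol carried by a deletion into the last block, so this symbol is reset
    to a blank. *)
Definition force (g : {ffun 'I_c -> op}) : {ffun 'I_c -> op} :=
  [ffun j => if (j == ord0) || (j == ord_max) then OConst (Some false)
  else if is_pop (g j) then OPop None else g j].

Definition nxt (j : 'I_c) : 'I_c := inord (j.+1 %% c).
Definition prv (j : 'I_c) : 'I_c := if val j is k.+1 then inord k else ord_max.

Definition pass_state : finType :=
  ((Q * {ffun 'I_c -> op} * 'I_c * bool)
   + (Q * {ffun 'I_c -> op} * {ffun 'I_c -> sym} * 'I_c) + bool)%type.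

Definition RS q o j b : pass_state := inl (inl (q, o, j, b)).
Definition LS q o bf j : pass_state := inl (inr (q, o, bf, j)).
Definition HS b : pass_state := inr b.

(* One step of the stack machine is a pass to the right, which performs the insertions and
   appends one block, followed by a pass to the left, which performs the deletions and collects
   the tops. The first and the last cell of every block hold bits (see [force]), so that a blank
   there marks the right, respectively left, end; only a block of the initial tape may have a
   blank last cell, and it is overwritten before the first pass to the left. *)
Definition pass_delta (s : pass_state) (h : sym) : pass_state * sym * move :=
  match s with
  | inl (inl (q, o, j, b)) =>
    let b' := b || ((j == ord0) && (h == None)) in
    let o' := fupd o j (right_step (o j) h).1 in
    if b' && (j == ord_max) then (LS q o' [ffun=> None] ord_max, (right_step (o j) h).2, Stay)
    else (RS q o' (nxt j) b', (right_step (o j) h).2, MoveR)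
  | inl (inr (q, o, bf, j)) =>
    if (j == ord_max) && (h == None) then
      match dl q bf with
      | None => (HS true, None, Stay)
      | Some (q', o') => (RS q' (force o') ord0 false, None, MoveR)
      end
    else (LS q (fupd o j (left_step (o j) h).1) (fupd bf j (left_step (o j) h).2) (prv j),
          (left_step (o j) h).2, MoveL)
  | inr b => (HS b, h, Stay)
  end.

Definition stack_TM : TM := mkTM pass_delta (RS q0 (force o0) ord0 false) (HS true) (HS false).

Definition stack_step := fstep pass_delta (HS true) (HS false).

Definition half_tape (D : nat) (W : nat -> sym) : nat -> sym :=
  fun x => if x < D then None else W (x - D).

Lemma half_tape_upd D W y a : upd (half_tape D W) (D + y) a = half_tape D (upd W y a).
Proof.
apply: functional_extensionality => x; rewrite /upd /half_tape; case: eqP => [->|ne].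
  by rewrite ltnNge leq_addr /= addKn eqxx.
by case: ifP => // h; case: eqP => //; lia.
Qed.

Lemma half_tape_at D W y : half_tape D W (D + y) = W y.
Proof. by rewrite /half_tape ltnNge leq_addr /= addKn. Qed.

Definition col (W : nat -> sym) (j : nat) (i : nat) : sym := W (i * c + j).

Definition omod (y : nat) : 'I_c := inord (y %% c).

Lemma val_omod y : val (omod y) = y %% c.
Proof. by rewrite /= inordK // ltn_pmod. Qed.

Lemma omod_ord i (j : 'I_c) : omod (i * c + j) = j.
Proof. by apply: val_inj; rewrite val_omod modnMDl modn_small. Qed.

Definition region (W : nat -> sym) (n : nat) : Prop :=
  (forall i, i < n -> col W 0 i <> None) /\ (forall z, n * c <= z -> W z = None).

Section Pass.
Variables (q : Q) (o : {ffun 'I_c -> op}) (W : nat -> sym) (n : nat).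
Hypothesis regW : region W n.

(** The index counts the cells of column [j] among the first [y] cells of the tape. *)
Definition oR (y : nat) : {ffun 'I_c -> op} :=
  [ffun j : 'I_c => right_op (o j) (col W j) (y %/ c + (j < y %% c))].
Definition WR (y : nat) : nat -> sym :=
  fun z => if z < y then right_out (o (omod z)) (col W (z %% c)) (z %/ c) else W z.

Lemma col_at y : col W (y %% c) (y %/ c) = W y.
Proof. by rewrite /col -divn_eq. Qed.

Lemma oR_at y : oR y (omod y) = right_op (o (omod y)) (col W (y %% c)) (y %/ c).
Proof. by rewrite ffunE val_omod ltnn addn0. Qed.

Lemma oR_next y : fupd (oR y) (omod y) (right_step (oR y (omod y)) (W y)).1 = oR y.+1.
Proof.
apply/ffunP => j; rewrite ffunE oR_at -(col_at y).
rewrite -[_.1]/(right_op (o (omod y)) (col W (y %% c)) (y %/ c).+1).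
case: eqP => [->|/eqP ne]; rewrite ffunE ?val_omod.
- rewrite modnS divnS //; case: ifP => h; last by rewrite leqnn addn1 add0n.
  by rewrite ltn0 addn0.
- have nj : (j : nat) != y %% c by rewrite -val_omod.
  have jc := ltn_ord j.
  rewrite ffunE modnS divnS //; case: ifP => h; congr right_op.
    by move: h nj; rewrite dvdn_succ => /eqP ->; lia.
  by lia.
Qed.

Lemma WR_next y : upd (WR y) y (right_step (oR y (omod y)) (W y)).2 = WR y.+1.
Proof.
apply: functional_extensionality => z; rewrite /upd /WR ltnS (leq_eqVlt z).
by case: eqP => [->|_]; rewrite ?orTb ?orFb // oR_at /right_out col_at.
Qed.

Lemma WR_self y : WR y y = W y.
Proof. by rewrite /WR ltnn. Qed.

Lemma omod_max y : (omod y == ord_max) = (y %% c == c').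
Proof. by rewrite -val_eqE val_omod. Qed.

Lemma omod0 y : (omod y == ord0) = (y %% c == 0).
Proof. by rewrite -val_eqE val_omod. Qed.

Lemma nxt_omod y : nxt (omod y) = omod y.+1.
Proof. by apply: val_inj; rewrite val_omod /= inordK ?ltn_pmod // val_omod -addn1 modnDml addn1. Qed.

Lemma prv_omod y : prv (omod y.+1) = omod y.
Proof.
apply: val_inj; rewrite /prv val_omod modnS val_omod; case: ifP => h /=.
  by move: h; rewrite dvdn_succ => /eqP.
by rewrite inordK // ltn_pmod.
Qed.

Lemma rpass D y : y < n.+1 * c ->
  iter y stack_step (RS q o ord0 false, half_tape D W, D)
  = (RS q (oR y) (omod y) (n * c < y), half_tape D (WR y), D + y).
Proof.
elim: y => [_|y IH lt].
  rewrite ltn0 addn0 /=; congr (RS _ _ _ _, half_tape _ _, _).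
  - by apply/ffunP => j; rewrite ffunE div0n mod0n ltn0.
  - by apply: val_inj; rewrite val_omod mod0n.
rewrite iterS IH; last lia.
rewrite /stack_step /= half_tape_at !WR_self.
(* Block [n] is the first one whose leading cell is blank, so the flag rises when cell [n * c] is
   read. *)
have -> : (n * c < y) || (omod y == ord0) && (W y == None) = (n * c < y.+1).
  rewrite ltnS (leq_eqVlt (n * c) y) orbC; congr orb; rewrite omod0; apply/andP/eqP.
    move=> [/eqP y0 /eqP W0]; have [r1 r2] := regW.
    have := divn_eq y c; rewrite y0 addn0 => e.
    case: (ltnP (y %/ c) n) => h; first by case: (r1 _ h); rewrite /col addn0 -e.
    have h' : y %/ c <= n by rewrite -ltnS ltn_divLR //; apply: ltnW.
    by rewrite e; congr muln; lia.
  move=> <-; rewrite modnMl eqxx; split=> //; apply/eqP.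
  by case: regW => _; apply.
have -> : (n * c < y.+1) && (omod y == ord_max) = false.
  apply/negP => /andP[h1]; rewrite omod_max => /eqP h2.
  have e := divn_eq y c; rewrite h2 in e.
  have : n <= y %/ c by rewrite leq_divRL //; lia.
  by move=> h; nia.
by rewrite oR_next half_tape_upd WR_next nxt_omod addnS.
Qed.

Lemma rpass_end D :
  iter (n.+1 * c) stack_step (RS q o ord0 false, half_tape D W, D)
  = (LS q (oR (n.+1 * c)) [ffun=> None] ord_max, half_tape D (WR (n.+1 * c)), D + (n * c + c')).
Proof.
have e : n.+1 * c = (n * c + c').+1 by rewrite mulSn addnC addnS.
rewrite e iterS rpass; last by rewrite e.
rewrite /stack_step /= half_tape_at !WR_self.
have m : (n * c + c') %% c = c' by rewrite modnMDl modn_small.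
rewrite omod_max m eqxx andbT.
have -> : (n * c < n * c + c') || (omod (n * c + c') == ord0) && (W (n * c + c') == None).
  (* With blocks of a single cell, the flag is raised and used in the same step. *)
  rewrite omod0 m; case: (posnP c') => [c0|h]; last by rewrite -[X in X < _]addn0 ltn_add2l h.
  by case: regW => _ ->; rewrite ?c0 ?orbT // leq_addr.
by rewrite oR_next half_tape_upd WR_next.
Qed.

End Pass.

Section LeftPass.
Variables (q : Q) (o : {ffun 'I_c -> op}) (W : nat -> sym) (n : nat).
Hypothesis bitW : forall i, i <= n -> col W c' i <> None.

Definition WL (y : nat) : nat -> sym :=
  fun z => if y < z.+1 then left_out (o (omod z)) (col W (z %% c)) (z %/ c) else W z.

(* [oL y] and [WL y] describe the situation when the cells from [y] on have been processed. *)
Definition oL (y : nat) : {ffun 'I_c -> op} :=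
  [ffun j : 'I_c => if is_pop (o j) then OPop (col W j ((y + (c' - j)) %/ c)) else o j].

(** The quotient in [oL] is [(y - j) / c] rounded up, the index of the first cell of column [j] at
    or to the right of [y], which is the one read last. *)
Lemma oL_idx y (j : 'I_c) : j = omod y -> (y + (c' - j)) %/ c = y %/ c.
Proof.
move=> ->; rewrite val_omod {1}(divn_eq y c) -addnA subnKC ?divnMDl ?(divn_small (ltnSn c')) ?addn0 //.
by rewrite -ltnS ltn_pmod.
Qed.

Lemma oL_at y : oL y.+1 (omod y) = if is_pop (o (omod y)) then OPop (col W (y %% c) (y %/ c).+1) else o (omod y).
Proof.
rewrite ffunE; case: ifP => // _; congr OPop; rewrite val_omod; congr col.
have r := ltn_pmod y (ltn0Sn c').
have -> : y.+1 + (c' - y %% c) = (y %/ c).+1 * c.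
  by rewrite mulSn {1}(divn_eq y c); move: r; move: (y %% c) (_ * c) => r s; lia.
by rewrite mulnK.
Qed.

Lemma oL_next y : fupd (oL y.+1) (omod y) (left_step (oL y.+1 (omod y)) (W y)).1 = oL y.
Proof.
apply/ffunP => j; rewrite ffunE; case: eqP => [->|/eqP ne].
  rewrite oL_at [RHS]ffunE oL_idx // val_omod col_at.
  by case E: (is_pop _) => //=; case: (o _) E.
rewrite !ffunE; case: ifP => // _; congr (OPop (col _ _ _)).
have nj : (j : nat) != y %% c by rewrite -val_omod.
have jc := ltn_ord j; have yc := ltn_pmod y (ltn0Sn c').
rewrite {1 2}(divn_eq y c) -addnS -!addnA !divnMDl //; congr addn.
case: (ltnP (y %% c) j) => h.
  by rewrite !divn_small //; lia.
have E k : c <= k -> k < c + c -> k %/ c = 1.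
  by move=> h1 h2; rewrite -(subnKC h1) divnDl // divnn divn_small //; lia.
rewrite !E //; lia.
Qed.

Lemma left_step_oL y : (left_step (oL y.+1 (omod y)) (W y)).2 = left_out (o (omod y)) (col W (y %% c)) (y %/ c).
Proof. by rewrite oL_at /left_out; case E: (is_pop _) => //=; rewrite col_at; case: (o _) E. Qed.

Lemma WL_self y : WL y.+1 y = W y.
Proof. by rewrite /WL ltnn. Qed.

Lemma WL_next y : upd (WL y.+1) y (left_step (oL y.+1 (omod y)) (W y)).2 = WL y.
Proof.
apply: functional_extensionality => z; rewrite /upd /WL left_step_oL !ltnS.
by case: eqP => [->|ne]; [rewrite leqnn | have -> : (y < z) = (y <= z) by lia].
Qed.

(** Every visit to a column overwrites its entry in [bf], so the value from block 0 survives. The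
    top of column [j] is cell [j], hence the entry is final once the sweep has passed [j]. *)
Lemma lpass D y (bf : {ffun 'I_c -> sym}) : 0 < D -> y <= n.+1 * c -> 
  (forall j : 'I_c, y <= j -> bf j = left_out (o j) (col W j) 0) ->
  exists2 bf' : {ffun 'I_c -> sym}, (forall j, bf' j = left_out (o j) (col W j) 0) &
  iter y stack_step (LS q (oL y) bf (if y is y'.+1 then omod y' else ord_max), half_tape D (WL y), (D + y).-1)
  = (LS q (oL 0) bf' ord_max, half_tape D (WL 0), D.-1).
Proof.
move=> D0; elim: y bf => [|y IH] bf le hb.
  by exists bf => [j|]; [apply: hb | rewrite addn0].
rewrite iterSr addnS /= half_tape_at !WL_self.
have -> : (omod y == ord_max) && (W y == None) = false.
  apply/negP => /andP[]; rewrite omod_max => /eqP h1 /eqP h2.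
  case: (@bitW (y %/ c)); first by rewrite -ltnS ltn_divLR.
  by have := col_at W y; rewrite h1 => ->.
rewrite oL_next half_tape_upd WL_next.
have -> : prv (omod y) = if y is y'.+1 then omod y' else ord_max.
  by case: (y) => [|y']; [rewrite /prv val_omod mod0n | rewrite prv_omod].
apply: IH; first lia.
move=> j yj; rewrite ffunE left_step_oL; case: eqP => [e|/eqP ne].
  have -> : (y %% c) = j by rewrite e val_omod.
  rewrite -e; congr left_out; apply: divn_small; apply: leq_ltn_trans yj (ltn_ord j).
apply: hb; rewrite ltn_neqAle yj andbT; apply: contra ne => /eqP ->.
by rewrite -val_eqE val_omod modn_small.
Qed.

End LeftPass.

(** The ideal effect of every operation is cut off after block [n], the only block that a right pass
    appends. *)
Definition apply_ops (o : {ffun 'I_c -> op}) (n : nat) (W : nat -> sym) : nat -> sym :=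
  fun z => let j := omod z in let i := z %/ c in
    if is_pop (o j) then col W j i.+1 else if i <= n then op_effect (o j) (col W j) i else None.

Lemma col_apply_ops (o : {ffun 'I_c -> op}) n W (j : 'I_c) i :
  col (apply_ops o n W) j i =
  if is_pop (o j) then col W j i.+1 else if i <= n then op_effect (o j) (col W j) i else None.
Proof.
by rewrite {1}/col /apply_ops omod_ord divnMDl // (divn_small (ltn_ord j)) addn0.
Qed.

Lemma region_col W n (j : 'I_c) i : region W n -> n <= i -> col W j i = None.
Proof. by case=> _ h le; apply: h; rewrite (leq_trans _ (leq_addr _ _)) // leq_mul2r le orbT. Qed.

(** The cut after block [n] is invisible unless an operation writes beyond it: a constant bit fills
    an infinite column, and [ORepIns] puts a symbol at index 1, which is within the cut if
    [0 < n]. *)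
Lemma col_apply_ops_effect (o : {ffun 'I_c -> op}) n W (j : 'I_c) i :
  region W n -> 0 < n -> (forall b, o j <> OConst (Some b)) ->
  col (apply_ops o n W) j i = op_effect (o j) (col W j) i.
Proof.
move=> reg n0 no; rewrite col_apply_ops.
have N k : n <= k -> col W j k = None by apply: region_col.
case: ifP => [|np]; first by case: (o j).
case: (leqP i n) => // lt; case: (o j) np no => [|a|a|a b|[b|]|a] //= _ no; last by case: (no b).
- by rewrite N // ltnW.
- by case: i lt => // i lt; rewrite N.
- by case: i lt => // i lt; rewrite N // ltnW.
- by case: i lt => [|[|i]] lt //; [move: n0 lt; case: (n) | rewrite N].
Qed.

Lemma WR_col (o : {ffun 'I_c -> op}) W n (j : 'I_c) i : region W n ->
  col (WR o W (n.+1 * c)) j i = if i <= n then right_out (o j) (col W j) i else None.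
Proof.
move=> reg; rewrite {1}/col /WR omod_ord modnMDl divnMDl // (divn_small (ltn_ord j)) addn0.
rewrite (modn_small (ltn_ord j)).
have -> : (i * c + j < n.+1 * c) = (i <= n).
  by rewrite -ltn_divLR // divnMDl // (divn_small (ltn_ord j)) addn0.
by case: leqP => // lt; apply: (region_col _ reg); apply: ltnW.
Qed.

Lemma macro q (o : {ffun 'I_c -> op}) W n D : region W n -> 0 < D ->
  exists bf : {ffun 'I_c -> sym}, exists o',
  (forall j, bf j = col (apply_ops (force o) n W) j 0) /\
  iter (n.+1 * c + n.+1 * c) stack_step (RS q (force o) ord0 false, half_tape D W, D)
  = (LS q o' bf ord_max, half_tape D (apply_ops (force o) n W), D.-1).
Proof.
move=> reg D0; set fo := force o.
set W1 := WR fo W (n.+1 * c); set o1 := oR fo W (n.+1 * c).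
have o1E j : o1 j = right_op (fo j) (col W j) n.+1 by rewrite ffunE mulnK // modnMl ltn0 addn0.
have pop1 j : is_pop (o1 j) = is_pop (fo j) by rewrite o1E is_pop_right_op.
have W1E j i : col W1 (val (j : 'I_c)) i = if i <= n then right_out (fo j) (col W j) i else None.
  exact: WR_col.
have h1 z : n.+1 * c <= z -> W1 z = None.
  move=> le; rewrite /W1 /WR ltnNge le /=; case: reg => _; apply.
  by apply: leq_trans le; rewrite leq_mul2r leqnSn orbT.
have fpop j : is_pop (fo j) -> fo j = OPop None.
  by rewrite !ffunE; case: (_ || _) => //; case E: (is_pop (o j)) => //; rewrite E.
have h2 j a : o1 j = OPop a -> a = None.
  move=> e; have p : is_pop (fo j) by rewrite -pop1 e.
  by move: e; rewrite o1E right_op_pop // fpop // => -[].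
have fmax : fo ord_max = OConst (Some false) by rewrite ffunE eqxx orbT.
have f0 : fo ord0 = OConst (Some false) by rewrite ffunE eqxx.
have h3 : is_pop (o1 ord_max) = false by rewrite pop1 fmax.
have h4 i : i <= n -> col W1 c' i <> None.
  move=> le; rewrite -[c']/(val (ord_max : 'I_c)) W1E le fmax.
  by rewrite right_out_const.
(* Beyond the appended block everything is blank, as are the symbols that the deletions hold at the
   turning point. *)
have OL : oL o1 W1 (n.+1 * c) = o1.
  apply/ffunP => j; rewrite ffunE; case: ifP => // p.
  rewrite divnMDl // divn_small ?addn0; last by rewrite ltnS leq_subr.
  have -> : col W1 j n.+1 = None by rewrite W1E ltnn.
  by rewrite o1E right_op_pop -?pop1 // fpop // -pop1.
have WLE : WL o1 W1 (n.+1 * c) = W1.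
  apply: functional_extensionality => z; rewrite /WL ltnS; case: leqP => // le.
  rewrite (h1 z) // /left_out; case: ifP => _; last by rewrite col_at h1.
  rewrite /col h1 // (mulSn (z %/ c)) -addnA -divn_eq.
  by apply: leq_trans le (leq_addl _ _).
have WL0 : WL o1 W1 0 = apply_ops fo n W.
  apply: functional_extensionality => z; rewrite /WL /= /left_out pop1 /apply_ops -(val_omod z) !W1E.
  case: ifP => [p|np].
    case: (ltnP _ n) => h; first by rewrite right_out_pop.
    by rewrite (region_col _ reg) // leqW.
  by case: ifP => // _; rewrite right_out_effect // np.
have [j jc|bf' hb E] := @lpass q o1 W1 n h4 D (n.+1 * c) [ffun=> None] D0 (leqnn _).
  by have := ltn_ord j; rewrite ltnNge (leq_trans _ jc) // leq_pmull.
exists bf', (oL o1 W1 0); split.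
  move=> j; rewrite hb -WL0 /col /WL /= mul0n add0n (modn_small (ltn_ord j)) (divn_small (ltn_ord j)).
  by congr left_out; congr (o1 _); apply: val_inj; rewrite val_omod (modn_small (ltn_ord j)).
rewrite iterD rpass_end // -/W1 -/o1.
rewrite WL0 in E; rewrite -E OL WLE mulSn /=.
have em : omod (c' + n * c) = ord_max.
  by apply/eqP; rewrite omod_max addnC modnMDl modn_small.
by rewrite em addSn addnS /= (addnC c').
Qed.

Lemma region_apply_ops (o : {ffun 'I_c -> op}) n W : region W n -> region (apply_ops (force o) n W) n.+1.
Proof.
move=> reg; split=> [i lt|z le].
  rewrite -[0]/(val (ord0 : 'I_c)) col_apply_ops ffunE /=.
  by rewrite -ltnS lt.
have h : n < z %/ c by rewrite leq_divRL.
by rewrite /apply_ops (leqNgt (z %/ c)) h (region_col _ reg) ?if_same // ltnW // ltnW.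
Qed.

Definition start_config q o W D : pass_state * (nat -> sym) * nat := (RS q (force o) ord0 false, half_tape D W, D).

Lemma macro_step q (o : {ffun 'I_c -> op}) W n D : region W n -> 0 < D ->
  let W' := apply_ops (force o) n W in
  let c2 := iter (n.+1 * c + n.+1 * c).+1 stack_step (start_config q o W D) in
  match dl q [ffun j : 'I_c => col W' j 0] with
  | None => c2.1.1 = HS true
  | Some (q', o') => c2 = start_config q' o' W' D
  end.
Proof.
move=> reg D0 W' c2; have [bf [o' [hb E]]] := macro q o reg D0.
have -> : [ffun j : 'I_c => col W' j 0] = bf by apply/ffunP => j; rewrite ffunE hb.
rewrite /c2 iterS E /stack_step /=.
(* The cell before the region is visited as the last cell of a block; being blank, it ends the left
   pass. *)
have -> : half_tape D (apply_ops (force o) n W) D.-1 = None by rewrite /half_tape; case: ifP => //; lia.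
rewrite eqxx /=; case: (dl q bf) => [[q' o'']|] //=.
rewrite /start_config prednK //; congr (_, _, _).
apply: functional_extensionality => x; rewrite /upd; case: eqP => // ->.
by rewrite /half_tape; case: ifP => //; lia.
Qed.

Fixpoint stack_accepts (k n : nat) (q : Q) (W : nat -> sym) : bool :=
  if k is k'.+1 then
    match dl q [ffun j : 'I_c => col W j 0] with
    | None => true
    | Some (q', o') => stack_accepts k' n.+1 q' (apply_ops (force o') n W)
    end
  else false.

Lemma stack_accepts_mono k k' n q W : k <= k' -> stack_accepts k n q W -> stack_accepts k' n q W.
Proof.
elim: k k' n q W => [//|k IH] [//|k'] n q W le /=.
by case: (dl _ _) => [[q' o']|] //; apply: IH.
Qed.

Lemma stack_step_sound T q (o : {ffun 'I_c -> op}) W n D : region W n -> 0 < D ->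
  (iter T stack_step (start_config q o W D)).1.1 = HS true ->
  exists k, stack_accepts k n.+1 q (apply_ops (force o) n W).
Proof.
have [N le] := ubnP T; elim: N T le q o W n => // N IH T le q o W n reg D0 acc.
move: (macro_step q o reg D0); cbv zeta.
set t := (_ + _).+1; set W' := apply_ops _ _ _.
case E: (dl _ _) => [[q' o']|] e; last by exists 1; rewrite /= E.
have acc' : (iter T stack_step (start_config q o W D)).1.1 == HS true by rewrite acc.
case: (leqP t T) => h.
  move: acc; rewrite -(subnK h) iterD e => acc.
  have lt : T - t < N by move: le h; rewrite /t; lia.
  have [k hk] := IH _ lt _ _ _ _ (region_apply_ops o reg) D0 acc.
  by exists k.+1; rewrite /= E.
(* A run that has halted before the end of the macro step would still be halted there, but it is
   then in a start configuration. *)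
have hh : ((iter T stack_step (start_config q o W D)).1.1 == HS true) ||
          ((iter T stack_step (start_config q o W D)).1.1 == HS false) by rewrite acc'.
have := iter_fstep_halted_le (ltnW h) hh; rewrite -/stack_step => e2.
by move: acc; rewrite -e2 e.
Qed.

(** Each of the [k] macro steps crosses at most [n + k + 1] blocks in either direction and adds one
    step for the transition. *)
Lemma stack_step_complete k q (o : {ffun 'I_c -> op}) W n D : region W n -> 0 < D ->
  stack_accepts k n.+1 q (apply_ops (force o) n W) ->
  forall T, k * ((n + k).+1 * c + (n + k).+1 * c).+1 <= T ->
  (iter T stack_step (start_config q o W D)).1.1 = HS true.
Proof.
elim: k q o W n => [//|k IH] q o W n reg D0.
move: (macro_step q o reg D0); cbv zeta.
set t := (n.+1 * _ + _).+1; set W' := apply_ops _ _ _.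
case E: (dl _ _) => [[q' o']|] e acc T le.
  rewrite /= E in acc.
  have tT : t <= T.
    apply: leq_trans le; rewrite mulSn; apply: leq_trans (leq_addr _ _).
    by rewrite /t ltnS leq_add // leq_mul2r ltnS leq_addr orbT.
  rewrite -(subnK tT) iterD e.
  apply: (IH _ _ _ _ (region_apply_ops o reg) D0 acc).
  have : t + k * (((n.+1 + k).+1 * c + (n.+1 + k).+1 * c).+1) <= T.
    apply: leq_trans le; rewrite (mulSn k); apply: leq_add.
      by rewrite /t ltnS leq_add // leq_mul2r ltnS leq_addr orbT.
    by rewrite addSnnS.
  by lia.
have tT : t <= T.
  apply: leq_trans le; rewrite mulSn; apply: leq_trans (leq_addr _ _).
  by rewrite /t ltnS leq_add // leq_mul2r ltnS leq_addr orbT.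
have hh : ((iter t stack_step (start_config q o W D)).1.1 == HS true) ||
          ((iter t stack_step (start_config q o W D)).1.1 == HS false) by rewrite e.
by rewrite (iter_fstep_halted_le tT hh).
Qed.

End StackMachine.

(** * A verifier running three clocked simulations *)

Definition track (r : 'I_3) (a : nat) : 'I_44 := inord (2 * (7 * r + a) + 1).

Lemma val_track r a : a < 7 -> track r a = 2 * (7 * r + a) + 1 :> nat.
Proof. by move=> h; rewrite /= inordK //; have := ltn_ord r; lia. Qed.

Definition track_op (r : 'I_3) (g : nat -> op) : {ffun 'I_44 -> op} :=
  [ffun j : 'I_44 => if odd j && (j < 43) && (j./2 %/ 7 == r) then g (j./2 %% 7) else OId].

Lemma track_opE r g r' a : a < 7 ->
  track_op r g (track r' a) = if r' == r then g a else OId.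
Proof.
move=> h; rewrite ffunE val_track // -val_eqE.
have r3 := ltn_ord r'.
have -> : odd (2 * (7 * r' + a) + 1) && (2 * (7 * r' + a) + 1 < 43) by lia.
have -> : (2 * (7 * r' + a) + 1)./2 = r' * 7 + a by lia.
by rewrite divnMDl // divn_small // addn0 modnMDl modn_small.
Qed.

Definition track_at (W : nat -> sym) (r : 'I_3) (a : nat) (i : nat) : sym := col 43 W (track r a) i.

Definition frame (r : 'I_3) (s : seq nat) (W W' : nat -> sym) : Prop :=
  forall (r' : 'I_3) a i, a < 7 -> (r' != r) || (a \notin s) -> track_at W' r' a i = track_at W r' a i.

Lemma frame_trans r s W1 W2 W3 : frame r s W1 W2 -> frame r s W2 W3 -> frame r s W1 W3.
Proof. by move=> h1 h2 r' a i ha hr; rewrite h2 ?h1. Qed.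

Lemma frame_sub r s s' W1 W2 : {subset s <= s'} -> frame r s W1 W2 -> frame r s' W1 W2.
Proof.
move=> sub h r' a i ha /orP[hr|hr]; apply: h; rewrite ?hr // orbC.
by apply/orP; left; apply: contra hr; apply: sub.
Qed.

Definition well_formed (n : nat) (W : nat -> sym) : Prop := region 43 W n /\ 0 < n.

Lemma track_at_apply_ops (o : {ffun 'I_44 -> op}) n W r a i : well_formed n W -> a < 7 ->
  (forall b, o (track r a) <> OConst (Some b)) ->
  track_at (apply_ops (force o) n W) r a i = op_effect (o (track r a)) (track_at W r a) i.
Proof.
move=> [reg n0] a7 nc; have r3 := ltn_ord r.
have E : force o (track r a) = if is_pop (o (track r a)) then OPop None else o (track r a).
  have e0 : (track r a == ord0) = false.
    by apply/eqP => /(congr1 (@nat_of_ord 44)); rewrite val_track //=; lia.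
  have e1 : (track r a == ord_max) = false.
    by apply/eqP => /(congr1 (@nat_of_ord 44)); rewrite val_track //=; lia.
  by rewrite ffunE e0 e1.
rewrite /track_at col_apply_ops_effect // E; first by case: (o (track r a)).
by case: ifP.
Qed.

Lemma track_at_apply r g n W r' a i : well_formed n W -> a < 7 -> (forall a b, g a <> OConst (Some b)) ->
  track_at (apply_ops (force (track_op r g)) n W) r' a i =
  if r' == r then op_effect (g a) (track_at W r a) i else track_at W r' a i.
Proof.
move=> gd a7 nc; rewrite track_at_apply_ops // track_opE //; first by case: eqP => [->|].
by case: ifP.
Qed.

Section Program.
Variables (Qm : finType) (dm : Qm -> sym -> Qm * sym * move).
Variables (sm : nat -> Qm) (am rm : pred Qm).

Definition PQ : finType := ('I_3 * 'I_3 + 'I_3 * Qm + unit)%type.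
Definition load (r : 'I_3) (s : nat) : PQ := inl (inl (r, inord s)).
Definition sim (r : 'I_3) (q : Qm) : PQ := inl (inr (r, q)).
Definition failed : PQ := inr tt.

(** Phases 0, 1, 2 test [y] for [L], [x] for [L] and [z] for [B]. Success of phase 0 or 2 accepts,
    success of phase 1 leads to phase 2, and only a failure of phase 0 leaves a second chance; this
    evaluates the disjunction. *)
Definition on_success (r : 'I_3) : option PQ :=
  if r == 1 :> nat then Some (load (inord 2) 0) else None.
Definition on_failure (r : 'I_3) : PQ :=
  if r == 0 :> nat then load (inord 1) 0 else failed.

Definition idle (a : nat) : op := OId.
Definition is_one (a : sym) : bool := if a is Some b then b else false.

(* Roles of the seven tracks of a phase: 0 instance, 1 instance flags, 2 certificate,
   3 certificate flags, 4 clock, 5 head and right part of the simulated tape, 6 left part.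
   The simulated tape is built by pushing the certificate, a blank and the instance (reversed
   twice, via track 6), so it is well formed whatever the given certificate contains. The clock
   is needed because a verifier may accept wrongly after its time bound. *)
Definition prog (q : PQ) (bf : {ffun 'I_44 -> sym}) : option (PQ * {ffun 'I_44 -> op}) :=
  match q with
  | inl (inl (r, s)) =>
    let u a := bf (track r a) in
    match val s with
    | 0 => match u 3 with
           | Some b => Some (q, track_op r (fun a => match a with
               | 2 | 3 => OPop None
               | 5 => if b then OIns (Some (is_one (u 2))) else OId | _ => OId end))
           | None => Some (load r 1, track_op r (fun a => if a is 5 then OIns None else OId))
           end
    | 1 => if is_one (u 1) then
             Some (q, track_op r (fun a => match a with
               | 0 | 1 => OPop None | 6 => OIns (Some (is_one (u 0))) | _ => OId end))
           else Some (load r 2, track_op r idle)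
    | _ => match u 6 with
           | Some b => Some (q, track_op r (fun a => match a with
               | 5 => OIns (Some b) | 6 => OPop None | _ => OId end))
           | None => Some (sim r (sm r), track_op r idle)
           end
    end
  | inl (inr (r, p)) =>
    let u a := bf (track r a) in
    if am p then if on_success r is Some q' then Some (q', track_op r idle) else None
    else if rm p || ~~ is_one (u 4) then Some (on_failure r, track_op r idle)
    else let: (p', w, m) := dm p (u 5) in
      Some (sim r p', track_op r (fun a => match a with
        | 4 => OPop None
        | 5 => match m with Stay => ORep w | MoveR => OPop None | MoveL => ORepIns (u 6) w end
        | 6 => match m with Stay => OId | MoveR => OIns w | MoveL => OPop None end
        | _ => OId end))
  | inr _ => Some (failed, track_op ord0 idle)
  end.

Definition tops (W : nat -> sym) : {ffun 'I_44 -> sym} := [ffun j : 'I_44 => col 43 W j 0].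
Notation paccepts := (stack_accepts prog).

Lemma prog_step n q W r g q' s : well_formed n W -> (forall a b, g a <> OConst (Some b)) ->
  (forall a, a \notin s -> g a = OId) ->
  prog q (tops W) = Some (q', track_op r g) ->
  exists W', [/\ well_formed n.+1 W', frame r s W W',
    forall a i, a < 7 -> track_at W' r a i = op_effect (g a) (track_at W r a) i &
    forall k, paccepts k.+1 n q W = paccepts k n.+1 q' W'].
Proof.
move=> gd nc gs E; exists (apply_ops (force (track_op r g)) n W); split.
- by case: gd => reg n0; split=> //; apply: region_apply_ops.
- move=> r' a i a7 h; rewrite track_at_apply //; case: eqP h => // -> /= h.
  by rewrite gs.
- by move=> a i a7; rewrite track_at_apply // eqxx.
- by move=> k /=; rewrite [X in prog q X]/(tops W) E.
Qed.

Lemma tops_track W r a : tops W (track r a) = track_at W r a 0.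
Proof. by rewrite ffunE. Qed.

(** The flag track has three values: a blank ends the certificate, [Some false] skips a cell,
    [Some true] admits its bit. Skipping is needed because on every track the blocks of the instance
    come before those of the certificate. *)
Lemma load_cert m n W r (rho : seq sym) : well_formed n W ->
  (forall i, i < m -> track_at W r 3 i <> None) -> track_at W r 3 m = None ->
  (forall i, track_at W r 5 i = nth None rho i) ->
  let w := [seq is_one (track_at W r 2 i) | i <- iota 0 m & is_one (track_at W r 3 i)] in
  exists W', [/\ well_formed (n + m.+1) W', frame r [:: 2; 3; 5] W W',
    forall i, track_at W' r 5 i = nth None (None :: map Some (rev w) ++ rho) i &
    forall k, paccepts (m.+1 + k) n (load r 0) W = paccepts k (n + m.+1) (load r 1) W'].
Proof.
elim: m n W rho => [|m IH] n W rho gd h1 h2 h5 w.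
  have [|a||W' [g' fr hU hk]] := @prog_step n (load r 0) W r
      (fun a => if a is 5 then OIns None else OId) (load r 1) [:: 2; 3; 5] gd.
  - by case=> [|[|[|[|[|[|?]]]]]].
  - by move: a; case=> [|[|[|[|[|[|?]]]]]].
  - by rewrite /prog /load /= inordK // !tops_track h2.
  exists W'; split; rewrite ?addn1 //.
  by case=> [|i]; rewrite hU //= h5.
case e3 : (track_at W r 3 0) => [b|]; last by case: (h1 0).
have [|a||W1 [g1 fr1 hU hk]] := @prog_step n (load r 0) W r
  (fun a => match a with
               | 2 | 3 => OPop None
               | 5 => if b then OIns (Some (is_one (track_at W r 2 0))) else OId | _ => OId end)
   (load r 0) [:: 2; 3; 5] gd.
- by case=> [|[|[|[|[|[|?]]]]]] //; case: (b).
- by move: a; case=> [|[|[|[|[|[|?]]]]]].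
- by rewrite /prog /load /= inordK // !tops_track e3.
have [|||W2 [g2 fr2 hU2 hk2]] := IH n.+1 W1 (if b then Some (is_one (track_at W r 2 0)) :: rho else rho) g1.
- by move=> i lt; rewrite hU //=; apply: h1.
- by rewrite hU.
- by move=> i; rewrite hU //; case: (b) => //=; case: i => [|i] //=; rewrite h5.
exists W2; rewrite -addSnnS; split => //.
- exact: frame_trans fr1 fr2.
- move=> i; rewrite hU2; congr nth; congr (_ :: _).
  have -> : w = (if b then [:: is_one (track_at W r 2 0)] else [::]) ++
     [seq is_one (track_at W1 r 2 i) | i <- iota 0 m & is_one (track_at W1 r 3 i)].
    have E : [seq is_one (track_at W r 2 i) | i <- iota 1 m & is_one (track_at W r 3 i)]
        = [seq is_one (track_at W1 r 2 i) | i <- iota 0 m & is_one (track_at W1 r 3 i)].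
      rewrite (iotaDl 1 0) filter_map -map_comp.
      rewrite (@eq_filter _ _ (fun i => is_one (track_at W1 r 3 i))); last by move=> j /=; rewrite hU.
      by apply: eq_map => j /=; rewrite hU.
    by rewrite /w /= e3 /=; case: (b) => /=; rewrite E.
  by case: (b) => //=; rewrite rev_cons map_rcons cat_rcons.
- by move=> k; rewrite addSn hk hk2.
Qed.

Lemma load_instance (xi : seq bool) n W r (la : seq sym) : well_formed n W ->
  (forall i, i < size xi -> track_at W r 1 i = Some true) -> is_one (track_at W r 1 (size xi)) = false ->
  (forall i, i < size xi -> track_at W r 0 i = Some (nth false xi i)) ->
  (forall i, track_at W r 6 i = nth None la i) ->
  exists W', [/\ well_formed (n + (size xi).+1) W', frame r [:: 0; 1; 6] W W',
    forall i, track_at W' r 6 i = nth None (map Some (rev xi) ++ la) i &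
    forall k, paccepts ((size xi).+1 + k) n (load r 1) W = paccepts k (n + (size xi).+1) (load r 2) W'].
Proof.
elim: xi n W la => [|b xi IH] n W la gd h1 h2 h0 h6.
  have [|a||W' [g' fr hU hk]] := @prog_step n (load r 1) W r idle (load r 2) [:: 0; 1; 6] gd.
  - by [].
  - by [].
  - by rewrite /prog /load /= inordK // !tops_track h2.
  exists W'; split; rewrite ?addn1 //.
  by move=> i; rewrite hU //= h6.
have [|a||W1 [g1 fr1 hU hk]] := @prog_step n (load r 1) W r
  (fun a => match a with
               | 0 | 1 => OPop None | 6 => OIns (Some b) | _ => OId end)
   (load r 1) [:: 0; 1; 6] gd.
- by case=> [|[|[|[|[|[|[|?]]]]]]].
- by move: a; case=> [|[|[|[|[|[|[|?]]]]]]].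
- by rewrite /prog /load /= inordK // !tops_track h1 // h0.
have [||||W2 [g2 fr2 hU2 hk2]] := IH n.+1 W1 (Some b :: la) g1.
- by move=> i lt; rewrite hU //=; apply: h1.
- by rewrite hU.
- by move=> i lt; rewrite hU //=; apply: h0.
- by move=> i; rewrite hU //=; case: i => [|i] //=; rewrite h6.
exists W2; rewrite -[size (b :: xi)]/(size xi).+1 -addSnnS; split => //.
- exact: frame_trans fr1 fr2.
- by move=> i; rewrite hU2 rev_cons map_rcons cat_rcons.
- by move=> k; rewrite addSn hk hk2.
Qed.

Lemma load_reversed (ze : seq bool) n W r (rho : seq sym) : well_formed n W ->
  (forall i, track_at W r 6 i = nth None (map Some ze) i) ->
  (forall i, track_at W r 5 i = nth None rho i) ->
  exists W', [/\ well_formed (n + (size ze).+1) W', frame r [:: 5; 6] W W',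
    forall i, track_at W' r 5 i = nth None (map Some (rev ze) ++ rho) i,
    forall i, track_at W' r 6 i = None &
    forall k, paccepts ((size ze).+1 + k) n (load r 2) W = paccepts k (n + (size ze).+1) (sim r (sm r)) W'].
Proof.
elim: ze n W rho => [|b ze IH] n W rho gd h6 h5.
  have [|a||W' [g' fr hU hk]] := @prog_step n (load r 2) W r idle (sim r (sm r)) [:: 5; 6] gd.
  - by [].
  - by [].
  - by rewrite /prog /load /= inordK // !tops_track h6.
  exists W'; split; rewrite ?addn1 //.
    by move=> i; rewrite hU //= h5.
  by move=> i; rewrite hU //= h6 nth_nil.
have [|a||W1 [g1 fr1 hU hk]] := @prog_step n (load r 2) W r
  (fun a => match a with
               | 5 => OIns (Some b) | 6 => OPop None | _ => OId end)
   (load r 2) [:: 5; 6] gd.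
- by case=> [|[|[|[|[|[|[|?]]]]]]].
- by move: a; case=> [|[|[|[|[|[|[|?]]]]]]].
- by rewrite /prog /load /= inordK // !tops_track h6.
have [||W2 [g2 fr2 hU2 hU3 hk2]] := IH n.+1 W1 (Some b :: rho) g1.
- by move=> i; rewrite hU //= h6.
- by move=> i; rewrite hU //=; case: i => [|i] //=; rewrite h5.
exists W2; rewrite -[size (b :: ze)]/(size ze).+1 -addSnnS; split => //.
- exact: frame_trans fr1 fr2.
- by move=> i; rewrite hU2 rev_cons map_rcons cat_rcons.
- by move=> k; rewrite addSn hk hk2.
Qed.

Section Phase.
Variables (M : TM) (e : 'I_(tm_Q M).+1 -> Qm) (r : 'I_3).
Hypothesis edm : forall q a, dm (e q) a = let: (q', w, m) := tm_delta q a in (e q', w, m).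
Hypothesis eam : forall q, am (e q) = (q == tm_acc M).
Hypothesis erm : forall q, rm (e q) = (q == tm_rej M).
Hypothesis esm : sm r = e (tm_start M).

Definition continue_as (b : bool) k n W : bool :=
  if b then if on_success r is Some q then paccepts k n q W else true
  else paccepts k n (on_failure r) W.

(** A machine that halts early ends its phase early, so [K] is only bounded; the answer agrees with
    that at time [t] because halted configurations do not change. Acceptance is tested before the
    clock, so accepting exactly at time [t] counts. *)
Lemma simulate t n W q l h rt : well_formed n W ->
  (forall i, i < t -> track_at W r 4 i = Some true) -> is_one (track_at W r 4 t) = false ->
  (forall i, track_at W r 5 i = nth None (h :: rt) i) -> (forall i, track_at W r 6 i = nth None l i) ->
  exists K n' W', [/\ well_formed n' W', frame r [:: 4; 5; 6] W W', K <= t.+1 &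
    forall k, paccepts (K + k) n (sim r (e q)) W
      = continue_as (cstate (iter t (@step M) (q, l, h, rt)) == tm_acc M) k n' W'].
Proof.
elim: t n W q l h rt => [|t IH] n W q l h rt gd h4 h4' h5 h6.
  case: (boolP (q == tm_acc M)) => [qa|qa].
    case E: (on_success r) => [q'|].
      have [|a||W' [g' fr hU hk]] := @prog_step n (sim r (e q)) W r idle q' [:: 4; 5; 6] gd => //.
        by rewrite /= eam qa E.
      by exists 1, n.+1, W'; split => // k; rewrite add1n hk /continue_as E.
    exists 1, n, W; split => // k; rewrite add1n /continue_as E /=.
    by rewrite eam qa E.
  have [|a||W' [g' fr hU hk]] := @prog_step n (sim r (e q)) W r idle (on_failure r) [:: 4; 5; 6] gd => //.
    by rewrite /= eam (negbTE qa) tops_track h4' orbT.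
  by exists 1, n.+1, W'; split => // k; rewrite add1n hk.
rewrite iterSr /= /halted.
case: (boolP (q == tm_acc M)) => [qa|qa] /=.
  have -> : cstate (iter t (@step M) (q, l, h, rt)) == tm_acc M.
    by elim: (t) => //= t'; case: (iter _ _ _) => [[[q1 l1] h1] r1] /= /eqP ->; rewrite /halted eqxx.
  case E: (on_success r) => [q'|].
    have [|a||W' [g' fr hU hk]] := @prog_step n (sim r (e q)) W r idle q' [:: 4; 5; 6] gd => //.
      by rewrite /= eam qa E.
    by exists 1, n.+1, W'; split => // k; rewrite add1n hk /continue_as E.
  exists 1, n, W; split => // k; rewrite add1n /continue_as E /=.
  by rewrite eam qa E.
case: (boolP (q == tm_rej M)) => [qr|qr] /=.
  have -> : cstate (iter t (@step M) (q, l, h, rt)) == tm_acc M = false.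
    have -> : iter t (@step M) (q, l, h, rt) = (q, l, h, rt).
      by elim: (t) => //= t' ->; rewrite /= /halted qr orbT.
    exact: negbTE.
  have [|a||W' [g' fr hU hk]] := @prog_step n (sim r (e q)) W r idle (on_failure r) [:: 4; 5; 6] gd => //.
    by rewrite /= eam erm (negbTE qa) qr.
  by exists 1, n.+1, W'; split => // k; rewrite add1n hk.
case D: (tm_delta q h) => [[q' w] m].
have [|a||W1 [g1 fr1 hU hk]] := @prog_step n (sim r (e q)) W r
  (fun a => match a with
        | 4 => OPop None
        | 5 => match m with Stay => ORep w | MoveR => OPop None | MoveL => ORepIns (head None l) w end
        | 6 => match m with Stay => OId | MoveR => OIns w | MoveL => OPop None end
        | _ => OId end) (sim r (e q')) [:: 4; 5; 6] gd.
- by case=> [|[|[|[|[|[|[|?]]]]]]] //; case: (m).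
- by move: a; case=> [|[|[|[|[|[|[|?]]]]]]].
- by rewrite /= !tops_track eam erm (negbTE qa) (negbTE qr) h4 // h5 h6 edm /= D nth0.
have H4 i : i < t -> track_at W1 r 4 i = Some true by move=> lt; rewrite hU //=; apply: h4.
have H4' : is_one (track_at W1 r 4 t) = false by rewrite hU.
have fin (l' : seq sym) h' (r' : seq sym) :
  (forall i, track_at W1 r 5 i = nth None (h' :: r') i) -> (forall i, track_at W1 r 6 i = nth None l' i) ->
  exists K n' W', [/\ well_formed n' W', frame r [:: 4; 5; 6] W W', K <= t.+2 &
    forall k, paccepts (K + k) n (sim r (e q)) W
      = continue_as (cstate (iter t (@step M) (q', l', h', r')) == tm_acc M) k n' W'].
  move=> h5' h6'; have [K [n' [W' [g' fr' le hk']]]] := IH n.+1 W1 q' l' h' r' g1 H4 H4' h5' h6'.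
  exists K.+1, n', W'; split => //; first exact: frame_trans fr1 fr'.
  by move=> k; rewrite addSn hk hk'.
case: m hU {D} => hU.
- by case: l h6 hU => [|a l] h6 hU; apply: fin => i; rewrite hU //= ?h6 ?nth_nil //;
    case: i => [|[|i]] //=; rewrite h5.
- by case: rt h5 hU => [|a rt] h5 hU; apply: fin => i; rewrite hU //= ?h5 ?nth_nil //;
    case: i => [|[|i]] //=; rewrite h6.
- by apply: fin => i; rewrite hU //=; case: i => [|i] //=; rewrite h5.
Qed.

Lemma phase (x : seq bool) t m n W : well_formed n W ->
  (forall i, i < m -> track_at W r 3 i <> None) -> track_at W r 3 m = None ->
  (forall i, i < size x -> track_at W r 1 i = Some true) -> is_one (track_at W r 1 (size x)) = false ->
  (forall i, i < size x -> track_at W r 0 i = Some (nth false x i)) ->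
  (forall i, i < t -> track_at W r 4 i = Some true) -> is_one (track_at W r 4 t) = false ->
  (forall i, track_at W r 5 i = None) -> (forall i, track_at W r 6 i = None) ->
  let w := rev [seq is_one (track_at W r 2 i) | i <- iota 0 m & is_one (track_at W r 3 i)] in
  exists K n' W', [/\ well_formed n' W', frame r (iota 0 7) W W',
    K <= m + 2 * size x + t + 4 &
    forall k, paccepts (K + k) n (load r 0) W
      = continue_as (cstate (run M t (encode_pair x w)) == tm_acc M) k n' W'].
Proof.
move=> gd h3 h3' h1 h1' h0 h4 h4' h5 h6 w.
have [||i|W1 [g1 fr1 hU1 hk1]] := @load_cert m n W r [::] gd => //.
  by rewrite h5 nth_nil.
have [|||i|W2 [g2 fr2 hU2 hk2]] := @load_instance x _ W1 r [::] g1.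
- by move=> i lt; rewrite fr1 ?orbT //; apply: h1.
- by rewrite fr1 ?orbT.
- by move=> i lt; rewrite fr1 ?orbT //; apply: h0.
- by rewrite fr1 ?orbT // h6 nth_nil.
have [|i|W3 [g3 fr3 hU3 hU3' hk3]] := @load_reversed (rev x) _ W2 r
    (None :: map Some w ++ [::]) g2.
- by move=> i; rewrite hU2 cats0.
- by rewrite fr2 ?orbT.
have [||i|i|K [n' [W4 [g4 fr4 le hk4]]]] := @simulate t _ W3 (tm_start M) [::]
   (head None (encode_pair x w)) (behead (encode_pair x w)) g3.
- by move=> i lt; rewrite fr3 ?orbT // fr2 ?orbT // fr1 ?orbT //; apply: h4.
- by rewrite fr3 ?orbT // fr2 ?orbT // fr1 ?orbT.
- rewrite hU3 revK cats0 /encode_pair; by case: (x).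
- by rewrite hU3' nth_nil.
exists (m.+1 + ((size x).+1 + ((size (rev x)).+1 + K))), n', W4; split => //.
- have sb s : all (fun a => a < 7) s -> {subset s <= iota 0 7}.
    by move=> /allP al a /al; rewrite mem_iota.
  apply: (frame_trans (frame_sub (sb [:: 2; 3; 5] isT) fr1)).
  apply: (frame_trans (frame_sub (sb [:: 0; 1; 6] isT) fr2)).
  apply: (frame_trans (frame_sub (sb [:: 5; 6] isT) fr3)).
  exact: (frame_sub (sb [:: 4; 5; 6] isT) fr4).
- by rewrite size_rev; lia.
- by move=> k; rewrite -!addnA hk1 hk2 hk3 esm hk4.
Qed.

End Phase.

Lemma failed_rejects k n W : paccepts k n failed W = false.
Proof. by elim: k n W => //= k IH n W; apply: IH. Qed.

End Program.

(** * Block-coded instances *)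

Lemma pboundE c k n : pbound c k n = c * expn n k + c.
Proof. by rewrite /pbound; congr (c * _ + c); elim: k => //= k ->; rewrite expnS. Qed.

(* Bit [p] of a block-coded string: cell [p %% 44] of block [p %/ 44]; the tracks are the
   cells [2 (7 r + a) + 1], all other cells hold [false]. *)
Definition layout (g : nat -> nat -> nat -> bool) (p : nat) : bool :=
  let j := p %% 44 in
  [&& odd j, j < 43 & g (j./2 %/ 7) (j./2 %% 7) (p %/ 44)].

Lemma layout_track g (r : 'I_3) a i : a < 7 -> layout g (i * 44 + track r a) = g r a i.
Proof.
move=> a7; have r3 := ltn_ord r; have h := ltn_ord (track r a).
rewrite /layout modnMDl divnMDl // (modn_small h) (divn_small h) addn0 val_track //.
have -> : odd (2 * (7 * r + a) + 1) by lia.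
have -> : 2 * (7 * r + a) + 1 < 43 by lia.
have -> : (2 * (7 * r + a) + 1)./2 = r * 7 + a by lia.
by rewrite divnMDl // divn_small // addn0 modnMDl modn_small.
Qed.

(** The head starts on the first cell and cannot reach bit [t] of the certificate in [t] steps.
    Hence the size of an extracted certificate never has to be controlled. *)
Lemma run_truncate (M : TM) t v w :
  cstate (run M t (encode_pair v w)) = cstate (run M t (encode_pair v (take t w))).
Proof.
rewrite !(@run_state M t t) //; apply: iter_fstep_agree => i le.
rewrite /tape_at; case: ifP => // h; rewrite /encode_pair !nth_cat size_map.
case: ifP => // h2; case E: (i - t - size v) => [|k] //=.
have kt : k < t by lia.
case: (ltnP k (size w)) => kw.
  have sz : k < size (take t w) by rewrite size_take; case: ifP.
  by rewrite !(nth_map false) // nth_take.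
by rewrite !nth_default // size_map // size_take; case: ifP => //; lia.
Qed.

Definition accepts_within (M : TM) (t : nat) (v : seq bool) : Prop :=
  exists w, size w <= t /\ cstate (run M t (encode_pair v w)) = tm_acc M.

Lemma accepts_withinI M t v w :
  cstate (run M t (encode_pair v w)) = tm_acc M -> accepts_within M t v.
Proof.
by move=> h; exists (take t w); rewrite -run_truncate h size_take; split=> //; case: ifP => //; lia.
Qed.

(** * The verifier, its instances and its certificates *)

Section Verifier.
Variables (ML MB : TM).

Definition mstate : finType := ('I_(tm_Q ML).+1 + 'I_(tm_Q MB).+1)%type.

Definition mdelta (q : mstate) (a : sym) : mstate * sym * move :=
  match q with
  | inl q => let: (q', w, m) := tm_delta q a in (inl q', w, m)
  | inr q => let: (q', w, m) := tm_delta q a in (inr q', w, m)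
  end.

Definition mstart (r : nat) : mstate := if r == 2 then inr (tm_start MB) else inl (tm_start ML).
Definition macc (q : mstate) : bool :=
  match q with inl q => q == tm_acc ML | inr q => q == tm_acc MB end.
Definition mrej (q : mstate) : bool :=
  match q with inl q => q == tm_rej ML | inr q => q == tm_rej MB end.

Notation vprog := (prog mdelta mstart macc mrej).

(** A certificate covers cells of all tracks, so the work tracks 5 and 6 are erased before the first
    phase. *)
Definition vclear : {ffun 'I_44 -> op} :=
  [ffun j : 'I_44 => if odd j && (j < 43) && (4 < j./2 %% 7) then OConst None else OId].

Definition verifier : TM := stack_TM vprog (load _ ord0 0) vclear.

(** Verification of [Ns] blocks takes time quadratic in [Ns]; the exponent 4 leaves room for the
    constants, since a nonempty instance has at least 43 cells. *)
Definition verified (s : seq bool) : Prop :=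
  exists w : seq bool, size w <= pbound 1 4 (size s) /\
    cstate (run verifier (pbound 1 4 (size s)) (encode_pair s w)) = tm_acc verifier.

Lemma verified_NP : in_NP verified.
Proof. by exists verifier, 1, 4. Qed.

Lemma verifier_accepts t s w :
  cstate (run verifier t (encode_pair s w)) = tm_acc verifier <->
  (iter t (stack_step vprog) (start_config (load _ ord0 0) vclear (nth None (encode_pair s w)) t.+1)).1.1
    = HS _ _ true.
Proof.
rewrite (@run_state verifier t t.+1) //.
have := mkTM_iter (pass_delta vprog) (RS (load _ ord0 0) (force vclear) ord0 false)
   (HS _ _ true) (HS _ _ false) t (RS (load _ ord0 0) (force vclear) ord0 false)
   (tape_at t.+1 (encode_pair s w)) t.+1.
rewrite -/(stack_step vprog) /start_config -[half_tape _ _]/(tape_at t.+1 (encode_pair s w)).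
case: (iter t (stack_step vprog) _) => [[q f] p] E.
rewrite -[tm_start verifier]/(enc _) E /=; split=> [|->] //.
exact: (can_inj (@decK _ _)).
Qed.

Section Instance.
Variables (x y z : seq bool) (tL tB Ns : nat).
(** Strict bounds leave a [false] behind every string and every clock within the instance itself, so
    a certificate cannot prolong them. *)
Hypotheses (szx : size x < Ns) (szy : size y < Ns) (szz : size z < Ns).
Hypotheses (ltL : tL < Ns) (ltB : tB < Ns).

Definition component (r : nat) : seq bool := match r with 0 => y | 1 => x | _ => z end.
Definition clock (r : nat) : nat := if r == 2 then tB else tL.

Definition instance_bits (r a i : nat) : bool :=
  match a with
  | 0 => nth false (component r) i
  | 1 => i < size (component r)
  | 4 => i < clock r
  | _ => false
  end.

(** One cell short of [Ns] blocks: the blank inserted by [encode_pair] completes the last block, and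
    the certificate starts at a block boundary. *)
Definition instance : seq bool := mkseq (layout instance_bits) (44 * Ns).-1.

Lemma size_instance : size instance = (44 * Ns).-1.
Proof. exact: size_mkseq. Qed.

Lemma size_component (r : 'I_3) : size (component r) < Ns.
Proof. by case: r => [[|[|[|?]]] ?]. Qed.

Lemma clock_lt (r : 'I_3) : clock r < Ns.
Proof. by rewrite /clock; case: ifP. Qed.

Section Certificate.
Variable w : seq bool.

Let W0 := nth None (encode_pair instance w).
Let n0 := Ns + (size w + 43) %/ 44.

Lemma tape_instance p : p < (44 * Ns).-1 -> W0 p = Some (layout instance_bits p).
Proof.
move=> h; rewrite /W0 /encode_pair nth_cat size_map size_instance h.
by rewrite (nth_map false) ?size_instance // nth_mkseq.
Qed.

Lemma tape_cert p : W0 (44 * Ns + p) = nth None (map Some w) p.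
Proof.
rewrite /W0 /encode_pair nth_cat size_map size_instance.
have -> : (44 * Ns + p < (44 * Ns).-1) = false by lia.
by have -> : 44 * Ns + p - (44 * Ns).-1 = p.+1 by lia.
Qed.

Lemma tape_region : region 43 W0 n0.
Proof.
split=> [i lt|p le]; last first.
  have -> : p = 44 * Ns + (p - 44 * Ns) by move: le; rewrite /n0; lia.
  by rewrite tape_cert nth_default // size_map; move: le; rewrite /n0; lia.
rewrite /col addn0; case: (ltnP i Ns) => h.
  by rewrite tape_instance //; lia.
have -> : i * 44 = 44 * Ns + (i - Ns) * 44 by lia.
by rewrite tape_cert (nth_map false) //; move: lt; rewrite /n0; lia.
Qed.

Let W1 := apply_ops (force vclear) n0 W0.

Lemma well_formed_tape : well_formed n0.+1 W1.
Proof. by split=> //; apply: region_apply_ops; apply: tape_region. Qed.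

Lemma track_at_tape (r : 'I_3) a i : a < 7 -> track_at W1 r a i = if 4 < a then None else track_at W0 r a i.
Proof.
move=> a7; have r3 := ltn_ord r.
have E : vclear (track r a) = if 4 < a then OConst None else OId.
  rewrite ffunE val_track //.
  have -> : odd (2 * (7 * r + a) + 1) && (2 * (7 * r + a) + 1 < 43) by lia.
  have -> : (2 * (7 * r + a) + 1)./2 = r * 7 + a by lia.
  by rewrite modnMDl modn_small.
rewrite track_at_apply_ops //; first by rewrite E; case: ifP.
  by split; [exact: tape_region | rewrite /n0; lia].
by move=> b; rewrite E; case: ifP.
Qed.

Lemma track_at_instance (r : 'I_3) a i : a < 7 -> i < Ns -> track_at W0 r a i = Some (instance_bits r a i).
Proof.
move=> a7 lt; rewrite /track_at /col tape_instance ?layout_track //.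
by rewrite val_track //; have := ltn_ord r; lia.
Qed.

Definition cert_len (r : 'I_3) : nat := find (fun i => track_at W1 r 3 i == None) (iota 0 n0).

Lemma cert_lenP (r : 'I_3) : [/\ cert_len r <= n0,
  forall i, i < cert_len r -> track_at W1 r 3 i <> None & track_at W1 r 3 (cert_len r) = None].
Proof.
have le : cert_len r <= n0 by rewrite -[n0](size_iota 0) find_size.
split=> // [i lt h|].
  by have := before_find 0 lt; rewrite nth_iota ?add0n ?h // (leq_trans lt).
case: (ltnP (cert_len r) n0) => h.
  have := @nth_find _ 0 (fun i => track_at W1 r 3 i == None) (iota 0 n0).
  by rewrite has_find size_iota => /(_ h); rewrite -/(cert_len r) nth_iota // add0n => /eqP.
by rewrite track_at_tape // /track_at (region_col _ tape_region).
Qed.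

(** The certificate that the machine extracts from [w]. Every [w] yields one, so soundness needs no
    assumption on its format. *)
Definition cert (r : 'I_3) : seq bool :=
  rev [seq is_one (track_at W1 r 2 i) | i <- iota 0 (cert_len r) & is_one (track_at W1 r 3 i)].

Definition ph (r : nat) : 'I_3 := inord r.

Definition verdict : bool :=
  (cstate (run ML tL (encode_pair y (cert (ph 0)))) == tm_acc ML) ||
  ((cstate (run ML tL (encode_pair x (cert (ph 1)))) == tm_acc ML) &&
   (cstate (run MB tB (encode_pair z (cert (ph 2)))) == tm_acc MB)).

Lemma phase_ready (r : 'I_3) n W : well_formed n W -> (forall a i, a < 7 -> track_at W r a i = track_at W1 r a i) ->
  [/\ forall i, i < cert_len r -> track_at W r 3 i <> None, track_at W r 3 (cert_len r) = None,
   forall i, i < size (component r) -> track_at W r 1 i = Some true,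
   is_one (track_at W r 1 (size (component r))) = false &
   (forall i, i < size (component r) -> track_at W r 0 i = Some (nth false (component r) i)) /\
   [/\ forall i, i < clock r -> track_at W r 4 i = Some true, is_one (track_at W r 4 (clock r)) = false,
   forall i, track_at W r 5 i = None, forall i, track_at W r 6 i = None &
   cert r = rev [seq is_one (track_at W r 2 i) | i <- iota 0 (cert_len r) & is_one (track_at W r 3 i)]]].
Proof.
move=> gd e; have [le h1 h2] := cert_lenP r.
have cl := clock_lt r; have sc := size_component r.
split; rewrite ?e //.
- by move=> i lt; rewrite e //; apply: h1.
- by move=> i lt; rewrite e // track_at_tape // track_at_instance ?(leq_trans lt) //= ?lt // ltnW.
- by rewrite track_at_tape // track_at_instance //= ltnn.
split.
  by move=> i lt; rewrite e // track_at_tape // track_at_instance // (ltn_trans lt).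
split; rewrite ?e //.
- by move=> i lt; rewrite e // track_at_tape // track_at_instance ?(ltn_trans lt) //= lt.
- by rewrite track_at_tape // track_at_instance //= ltnn.
- by move=> i; rewrite e // track_at_tape.
- by move=> i; rewrite e // track_at_tape.
- rewrite /cert; congr rev; rewrite (@eq_filter _ _ (fun i => is_one (track_at W r 3 i))).
    by apply: eq_map => i; rewrite e.
  by move=> i; rewrite e.
Qed.

Lemma run_phase (M : TM) (f : 'I_(tm_Q M).+1 -> mstate) (r : 'I_3) n W :
  (forall q a, mdelta (f q) a = let: (q', w, m) := tm_delta q a in (f q', w, m)) ->
  (forall q, macc (f q) = (q == tm_acc M)) -> (forall q, mrej (f q) = (q == tm_rej M)) ->
  mstart r = f (tm_start M) ->
  well_formed n W -> (forall a i, a < 7 -> track_at W r a i = track_at W1 r a i) ->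
  exists K n' W', [/\ well_formed n' W', frame r (iota 0 7) W W',
    K <= n0 + 3 * Ns + 4 &
    forall k, stack_accepts vprog (K + k) n (load _ r 0) W
      = continue_as mdelta mstart macc mrej r
         (cstate (run M (clock r) (encode_pair (component r) (cert r))) == tm_acc M) k n' W'].
Proof.
move=> e1 e2 e3 e4 gd e.
have [h1 h2 h3 h4 [h5 [h6 h7 h8 h9 h10]]] := phase_ready gd e.
have [K [n' [W' [g' fr le hk]]]] := phase e1 e2 e3 e4 gd h1 h2 h3 h4 h5 h6 h7 h8 h9.
exists K, n', W'; split => //; last by rewrite h10.
have [hle _ _] := cert_lenP r; have := clock_lt r; have := size_component r.
by move: le hle; lia.
Qed.

(** One equation for all step counts from [K] on serves both directions: [k = 0] bounds the time of
    an accepting run, and large [k] dominates any given one. *)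
Lemma verdictP : exists2 K, K <= 3 * (n0 + 3 * Ns + 4) &
  forall k, stack_accepts vprog (K + k) n0.+1 (load _ ord0 0) W1 = verdict.
Proof.
have p0 : ph 0 = 0 :> nat by rewrite inordK.
have p1 : ph 1 = 1 :> nat by rewrite inordK.
have p2 : ph 2 = 2 :> nat by rewrite inordK.
have pE : ord0 = ph 0 by apply: val_inj; rewrite /= p0.
have fl r1 r2 Wa Wb : frame r1 (iota 0 7) Wa Wb -> r2 != r1 ->
    forall a i, a < 7 -> track_at Wb r2 a i = track_at Wa r2 a i.
  by move=> fr ne a i a7; rewrite fr // ne.
have [||||||K0 [na [Wa [ga fra lea hka]]]] := @run_phase ML (@inl _ _) (ph 0) n0.+1 W1 => //.
- by rewrite /mstart p0.
- exact: well_formed_tape.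
have [||||||K1 [nb [Wb [gb frb leb hkb]]]] := @run_phase ML (@inl _ _) (ph 1) na Wa => //.
- by rewrite /mstart p1.
- by apply: fl fra _; rewrite -val_eqE /= p0 p1.
have [||||||K2 [nc [Wc [gc frc lec hkc]]]] := @run_phase MB (@inr _ _) (ph 2) nb Wb => //.
- by rewrite /mstart p2.
- move=> a i a7; rewrite (fl _ _ _ _ frb) // ?(fl _ _ _ _ fra) //.
    by rewrite -val_eqE /= p0 p2.
  by rewrite -val_eqE /= p1 p2.
exists (K0 + (K1 + K2)); first by move: lea leb lec; lia.
move=> k; rewrite -!addnA pE hka /verdict /continue_as.
rewrite /on_success /on_failure /clock /component p0 /=.
case: ifP => // _; rewrite -[@inord 2 1]/(ph 1) hkb /continue_as.
rewrite /on_success /on_failure /clock /component p1 /=.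
case: ifP => _ /=; last exact: failed_rejects.
rewrite -[@inord 2 2]/(ph 2) hkc /continue_as.
rewrite /on_success /on_failure /clock /component p2 /=.
by case: ifP => _ //; exact: failed_rejects.
Qed.

End Certificate.

Section HonestCertificate.
Variable cw : nat -> seq bool.
Hypothesis szcw : forall r, size (cw r) <= tL + tB.

(** Loading pushes the bits and so reverses them, hence the [rev]. The flags are [false] after the
    end of [cw r], which pads the three certificates to a common length. *)
Definition cert_bits (r a i : nat) : bool :=
  match a with
  | 2 => nth false (rev (cw r)) i
  | 3 => i < size (cw r)
  | _ => false
  end.

Definition joint_cert : seq bool := mkseq (layout cert_bits) (44 * (tL + tB)).

Lemma size_joint_cert : size joint_cert = 44 * (tL + tB).
Proof. exact: size_mkseq. Qed.

Lemma track_at_joint_cert (r : 'I_3) a i : a < 5 -> i < tL + tB ->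
  track_at (apply_ops (force vclear) (Ns + (size joint_cert + 43) %/ 44)
       (nth None (encode_pair instance joint_cert))) r a (Ns + i) = Some (cert_bits r a i).
Proof.
move=> a5 lt; rewrite track_at_tape; last lia.
have -> : 4 < a = false by lia.
have h : i * 44 + track r a < 44 * (tL + tB).
  by rewrite val_track; [have := ltn_ord r; lia | lia].
rewrite /track_at /col mulnDl (mulnC Ns) -addnA tape_cert (nth_map false) ?size_joint_cert //.
by rewrite nth_mkseq // layout_track //; lia.
Qed.

Lemma cert_joint_cert (r : 'I_3) : cert joint_cert r = cw r.
Proof.
have [le h1 h2] := cert_lenP joint_cert r.
have E : (size joint_cert + 43) %/ 44 = tL + tB by rewrite size_joint_cert; lia.
have cl : cert_len joint_cert r = Ns + (tL + tB).
  apply/eqP; rewrite eqn_leq -{1}E le /=; rewrite leqNgt; apply/negP => lt.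
  move: h2; case: (ltnP (cert_len joint_cert r) Ns) => h.
    by rewrite track_at_tape // track_at_instance.
  by rewrite -(subnKC h) track_at_joint_cert //; lia.
rewrite /cert cl iotaD add0n filter_cat map_cat.
have -> : [seq i <- iota 0 Ns | is_one (track_at (apply_ops (force vclear)
     (Ns + (size joint_cert + 43) %/ 44) (nth None (encode_pair instance joint_cert))) r 3 i)] = [::].
  apply/eqP; rewrite -size_eq0 size_filter eqn0Ngt -has_count; apply/hasPn => i.
  by rewrite mem_iota /= add0n => lt; rewrite track_at_tape // track_at_instance.
rewrite -[Ns in iota Ns _]addn0 iotaDl filter_map -map_comp /=.
have -> : [seq i <- iota 0 (tL + tB) | preim (addn Ns) (fun i => is_one (track_at (apply_ops (force vclear)
     (Ns + (size joint_cert + 43) %/ 44) (nth None (encode_pair instance joint_cert))) r 3 i)) i]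
  = iota 0 (size (cw r)).
  have le2 := szcw r; rewrite -(subnKC le2) iotaD filter_cat.
  rewrite (@eq_in_filter _ _ predT); last first.
    move=> i; rewrite mem_iota /= add0n => lt; rewrite track_at_joint_cert //=.
    exact: leq_trans lt le2.
  rewrite filter_predT (@eq_in_filter _ _ pred0) ?filter_pred0 ?cats0 //.
  move=> i; rewrite mem_iota add0n subnKC // => /andP[ge lt] /=.
  by rewrite track_at_joint_cert //= ltnNge ge.
apply: (can_inj revK); rewrite revK.
apply: (@eq_from_nth _ false); rewrite size_map size_iota ?size_rev // => i lt.
rewrite (nth_map 0) ?size_iota // nth_iota // add0n /= track_at_joint_cert //.
exact: leq_trans lt (szcw r).
Qed.

End HonestCertificate.

Lemma verified_instance : verified instance <->
  accepts_within ML tL y \/ (accepts_within ML tL x /\ accepts_within MB tB z).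
Proof.
have Ns0 : 0 < Ns by apply: leq_ltn_trans szx.
split.
  move=> [w [le]]; rewrite verifier_accepts => acc.
  have [k hk] := stack_step_sound (tape_region w) (ltn0Sn _) acc.
  have [K _ hK] := verdictP w.
  have : verdict w.
    by rewrite -(hK k); apply: stack_accepts_mono hk; apply: leq_addl.
  case/orP => [/eqP h|/andP[/eqP h /eqP h']]; [left | right; split]; exact: accepts_withinI h || exact: accepts_withinI h'.
move=> H.
have [cw szcw v] : exists2 cw : nat -> seq bool, (forall r, size (cw r) <= tL + tB) &
  (cstate (run ML tL (encode_pair y (cw 0))) == tm_acc ML) ||
  ((cstate (run ML tL (encode_pair x (cw 1))) == tm_acc ML) &&
   (cstate (run MB tB (encode_pair z (cw 2))) == tm_acc MB)).
  case: H => [[w [le h]]|[[w [le h]] [w' [le' h']]]].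
    exists (fun r => if r is 0 then w else [::]); last by rewrite h eqxx.
    by case=> //=; apply: leq_trans le (leq_addr _ _).
  exists (fun r => if r is 1 then w else w'); last by rewrite h h' !eqxx orbT.
  by case=> [|[|r]] /=; [apply: leq_trans le' (leq_addl _ _) | apply: leq_trans le (leq_addr _ _) | apply: leq_trans le' (leq_addl _ _)].
set w := joint_cert cw.
have sw : size w = 44 * (tL + tB) by apply: size_joint_cert.
have E : (size w + 43) %/ 44 = tL + tB by rewrite sw; lia.
have lt : tL + tB <= 2 * Ns by move: ltL ltB; lia.
have A4 : 43 * Ns * (43 * Ns * (43 * Ns * (43 * Ns))) <= pbound 1 4 (size instance).
  have -> a : a * (a * (a * a)) = expn a 4 by rewrite !expnS expn0 muln1.
  rewrite pboundE mul1n (leq_trans _ (leq_addr _ _)) // leq_exp2r // size_instance; lia.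
have big : 43 * Ns * (43 * Ns) <= 43 * Ns * (43 * Ns * (43 * Ns * (43 * Ns))).
  rewrite leq_mul2l; apply/orP; right; apply: leq_pmulr; rewrite muln_gt0; lia.
have a43 : 43 <= 43 * Ns by lia.
exists w; split.
  apply: leq_trans A4; apply: leq_trans big; rewrite sw.
  apply: (@leq_trans (43 * (43 * Ns))); first lia.
  by rewrite leq_mul2r a43 orbT.
rewrite verifier_accepts.
have [K leK hK] := verdictP w.
apply: (@stack_step_complete _ _ _ K _ _ _ _ _ (tape_region w) (ltn0Sn _)).
  rewrite -[K]addn0 hK /verdict !cert_joint_cert // /ph !inordK //.
rewrite E in leK *.
(* Three phases, each of at most [n0 + 3 * Ns + 4] steps with [n0] at most [3 * Ns]. *)
have K30 : K <= 30 * Ns by lia.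
apply: leq_trans A4.
apply: (@leq_trans (43 * Ns * (43 * 43 * 43 * Ns))).
  apply: leq_mul; first lia.
  by move: K30 lt; lia.
rewrite leq_mul2l; apply/orP; right.
have N3 : 43 * Ns <= 43 * Ns * (Ns * Ns) by apply: leq_pmulr; rewrite muln_gt0 Ns0.
by move: N3; move: (Ns * Ns) => q; rewrite ?mulnA; nia.
Qed.

End Instance.
End Verifier.

(** * Filling the input into the advice *)

Lemma upd_id f p : upd f p (f p) = f.
Proof. by apply: functional_extensionality => i; rewrite /upd; case: eqP => // ->. Qed.

Section Scan.
Variables (Q : eqType) (d : Q -> sym -> Q * sym * move) (ac re : Q).
Variables (q : Q) (f : nat -> sym).
Hypothesis nh : (q == ac) || (q == re) = false.

Lemma scan_right k a :
  (forall p, a <= p < a + k -> d q (f p) = (q, f p, MoveR)) ->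
  iter k (fstep d ac re) (q, f, a) = (q, f, a + k).
Proof.
elim: k a => [|k IH] a h; first by rewrite addn0.
have e : d q (f a) = (q, f a, MoveR) by apply: h; lia.
rewrite iterSr /= nh e upd_id /= addnS -addSn.
by apply: IH => p hp; apply: h; lia.
Qed.

Lemma scan_left k a : k <= a ->
  (forall p, a < p + k -> p <= a -> d q (f p) = (q, f p, MoveL)) ->
  iter k (fstep d ac re) (q, f, a) = (q, f, a - k).
Proof.
elim: k a => [|k IH] a le h; first by rewrite subn0.
have e : d q (f a) = (q, f a, MoveL) by apply: h; lia.
rewrite iterSr /= nh e upd_id /= IH; first by congr (_, _, _); lia.
- lia.
- by move=> p h1 h2; apply: h; lia.
Qed.

End Scan.

Section Filler.
Variable M : TM.

Definition fstate : finType := ('I_(tm_Q M).+1 + 'I_7 * bool)%type.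
Definition ctl (k : nat) (b : bool) : fstate := inr (inord k, b).

(* 0: pick the next input bit; 1: carry it to the advice; 2, 3: look for a cell of even
   index holding 1; 4: write the bit next to it; 5, 6: return through advice and input. *)
Definition fctl (k : nat) (b : bool) (h : sym) : fstate * sym * move :=
    match k, h with
    | 0, Some b' => (ctl 1 b', None, MoveR)
    | 0, None => (inl (tm_start M), None, MoveR)
    | 1, Some _ => (ctl 1 b, h, MoveR)
    | 1, None => (ctl 2 b, None, MoveR)
    | 2, Some true => (ctl 4 b, Some false, MoveR)
    | 2, _ => (ctl 3 b, h, MoveR)
    | 3, _ => (ctl 2 b, h, MoveR)
    | 4, _ => (ctl 5 b, Some b, MoveL)
    | 5, Some _ => (ctl 5 b, h, MoveL)
    | 5, None => (ctl 6 b, None, MoveL)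
    | _, Some _ => (ctl 6 b, h, MoveL)
    | _, None => (ctl 0 b, None, MoveR)
    end.

Definition fdelta (s : fstate) (h : sym) : fstate * sym * move :=
  match s with
  | inl q => let: (q', w, m) := tm_delta q h in (inl q', w, m)
  | inr (k, b) => fctl k b h
  end.

Definition filler : TM := mkTM fdelta (ctl 0 false) (inl (tm_acc M)) (inl (tm_rej M)).
Notation gs := (fstep fdelta (inl (tm_acc M)) (inl (tm_rej M))).

Lemma ctl_step k b f p : k < 7 -> gs (ctl k b, f, p) =
  let: (q', w, m) := fctl k b (f p) in (q', upd f p w, shift_head m p).
Proof. by move=> k7; rewrite /= inordK. Qed.

Lemma ctlE k b h : k < 7 -> fdelta (ctl k b) h = fctl k b h.
Proof. by move=> k7; rewrite /= inordK. Qed.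

Lemma inl_iter t q f p :
  iter t gs (inl q, f, p) =
  let: (q', f', p') := iter t (@mstep M) (q, f, p) in (inl q', f', p').
Proof.
elim: t => //= t ->; case: (iter t _ _) => [[q' f'] p'] /=.
have inl_eq (u v : 'I_(tm_Q M).+1) : ((inl u : fstate) == inl v) = (u == v) by [].
rewrite !inl_eq; case: ifP => // _.
by case: (tm_delta q' (f' p')) => [[? ?] ?].
Qed.

Section Fill.
(** [adv i] is the advice after [i] bits have been filled in, and [slot i] is the mark of the next
    gap. Only even cells before a mark have to be [false], since odd cells hold data and are skipped
    by the search. *)
Variables (z : seq bool) (adv : nat -> seq bool) (slot : nat -> nat) (E S : nat).
Hypothesis size_adv : forall i, size (adv i) = S.
Hypothesis slot_even : forall i, i < size z -> odd (slot i) = false.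
Hypothesis slot_lt : forall i, i < size z -> (slot i).+1 < S.
Hypothesis before_slot : forall i j, i < size z -> j < slot i -> odd j = false ->
  nth false (adv i) j = false.
Hypothesis at_slot : forall i, i < size z -> nth false (adv i) (slot i) = true.
Hypothesis fill_slot : forall i j, i < size z -> nth false (adv i.+1) j =
  if j == slot i then false else if j == (slot i).+1 then nth false z i else nth false (adv i) j.

(** Input bits that have been used are blanked, so that the way back ends at the first remaining
    one. *)
Definition ftape (i : nat) : nat -> sym := fun p =>
  if p < E + i then None else if p < E + size z then Some (nth false z (p - E))
  else if p == E + size z then None else nth None (map Some (adv i)) (p - (E + size z).+1).

Let n := size z.
Let B := (E + n).+1.

Lemma ftape_adv i j : j < S -> i <= n -> ftape i (B + j) = Some (nth false (adv i) j).
Proof.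
move=> jS le; rewrite /ftape /B addSn.
have -> : (E + n + j).+1 < E + i = false by lia.
have -> : (E + n + j).+1 < E + size z = false by rewrite -/n; lia.
have -> : (E + n + j).+1 == E + size z = false by apply/eqP; rewrite -/n; lia.
by rewrite -addSn -/n addKn (nth_map false) ?size_adv.
Qed.

Lemma ftape_z i p : E + i <= p < E + n -> ftape i p = Some (nth false z (p - E)).
Proof. by move=> /andP[h1 h2]; rewrite /ftape ltnNge h1 /= h2. Qed.

Lemma ftape_border i : i <= n -> ftape i (E + n) = None.
Proof. by move=> le; rewrite /ftape ltnn eqxx; case: ifP. Qed.

Lemma scan_slots b f k : (forall j, j < k.*2 -> exists c, f (B + j) = Some c /\ (odd j = false -> c = false)) ->
  iter k.*2 gs (ctl 2 b, f, B) = (ctl 2 b, f, B + k.*2).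
Proof.
elim: k => [|k IH] h; first by rewrite addn0.
rewrite doubleS !iterS IH; last by move=> j lt; apply: h; rewrite doubleS; lia.
have [|c [e1 c0]] := h k.*2; first by rewrite doubleS.
have e1' : f (B + k.*2) = Some false by rewrite e1 c0 // odd_double.
have st1 : gs (ctl 2 b, f, B + k.*2) = (ctl 3 b, f, (B + k.*2).+1).
  by rewrite ctl_step // e1' /= -e1' upd_id.
by rewrite st1 ctl_step //= upd_id !addnS.
Qed.

Lemma fill_round i b : i < n ->
  exists2 t, t <= 2 * n + 2 * S + 4 &
  iter t gs (ctl 0 b, ftape i, E + i) = (ctl 0 (nth false z i), ftape i.+1, E + i.+1).
Proof.
move=> lt; set c := nth false z i.
set f1 := upd (ftape i) (E + i) None.
have f1E p : p != E + i -> f1 p = ftape i p by rewrite /f1 /upd => /negbTE ->.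
have s1 : iter 1 gs (ctl 0 b, ftape i, E + i) = (ctl 1 c, f1, (E + i).+1).
  rewrite [iter 1 _ _]ctl_step // ftape_z; last by rewrite leqnn /=; lia.
  by rewrite addKn.
have s2 : iter (n - i.+1) gs (ctl 1 c, f1, (E + i).+1) = (ctl 1 c, f1, E + n).
  rewrite scan_right //; first by congr (_, _, _); lia.
  move=> p hp; rewrite f1E; last by apply/eqP; lia.
  by rewrite ctlE // ftape_z //; lia.
have fb : f1 (E + n) = None.
  by rewrite f1E ?ftape_border 1?ltnW //; apply/eqP; lia.
have s3 : iter 1 gs (ctl 1 c, f1, E + n) = (ctl 2 c, f1, B).
  by rewrite [iter 1 _ _]ctl_step // fb /= -fb upd_id.
have sl := slot_lt lt; have se : (slot i)./2.*2 = slot i by rewrite -[RHS]odd_double_half slot_even.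
have f1adv j : j < S -> f1 (B + j) = Some (nth false (adv i) j).
  by move=> jS; rewrite f1E ?ftape_adv // 1?ltnW //; apply/eqP; rewrite /B; lia.
have s4 : iter (slot i) gs (ctl 2 c, f1, B) = (ctl 2 c, f1, B + slot i).
  rewrite -se scan_slots // => j; rewrite se => js; exists (nth false (adv i) j); split.
    by rewrite f1adv //; lia.
  exact: before_slot.
set f2 := upd f1 (B + slot i) (Some false).
have s5 : iter 1 gs (ctl 2 c, f1, B + slot i) = (ctl 4 c, f2, (B + slot i).+1).
  by rewrite [iter 1 _ _]ctl_step // f1adv ?at_slot //; lia.
set f3 := upd f2 (B + slot i).+1 (Some c).
have s6 : iter 1 gs (ctl 4 c, f2, (B + slot i).+1) = (ctl 5 c, f3, B + slot i).
  by rewrite [iter 1 _ _]ctl_step //; case: (f2 _).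
have f3E p : p != B + slot i -> p != (B + slot i).+1 -> f3 p = f1 p.
  by rewrite /f3 /f2 /upd => /negbTE -> /negbTE ->.
have s7 : iter (slot i).+1 gs (ctl 5 c, f3, B + slot i) = (ctl 5 c, f3, E + n).
  rewrite scan_left //; first by congr (_, _, _); rewrite /B; lia.
    by rewrite /B; lia.
  move=> p h1 h2; rewrite ctlE //.
  suff [x ->] : exists x, f3 p = Some x by [].
  case: (eqVneq p (B + slot i)) => [->|ne].
    exists false; rewrite /f3 /upd /f2 /upd eqxx.
    by case: eqP => //; lia.
  rewrite f3E //; last by apply/eqP; lia.
  have -> : p = B + (p - B) by move: h1; rewrite /B; lia.
  by rewrite f1adv; [eexists | lia].
have s8 : iter 1 gs (ctl 5 c, f3, E + n) = (ctl 6 c, f3, (E + n).-1).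
  have e : f3 (E + n) = None.
    rewrite f3E; try (by apply/eqP; rewrite /B; lia).
    by rewrite f1E ?ftape_border 1?ltnW //; apply/eqP; lia.
  by rewrite [iter 1 _ _]ctl_step // e /= -e upd_id.
have s9 : iter (n - i.+1) gs (ctl 6 c, f3, (E + n).-1) = (ctl 6 c, f3, E + i).
  rewrite scan_left //; first by congr (_, _, _); lia.
    by lia.
  move=> p h1 h2; rewrite ctlE //.
  rewrite f3E; try (by apply/eqP; rewrite /B; lia).
  by rewrite f1E ?ftape_z //; [lia | apply/eqP; lia].
have s10 : iter 1 gs (ctl 6 c, f3, E + i) = (ctl 0 c, f3, E + i.+1).
  have e : f3 (E + i) = None.
    rewrite f3E; try (by apply/eqP; rewrite /B; lia).
    by rewrite /f1 /upd eqxx.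
  by rewrite [iter 1 _ _]ctl_step // e /= -e upd_id addnS.
have fE : f3 = ftape i.+1.
  apply: functional_extensionality => p.
  case: (ltnP p B) => pB.
    rewrite f3E; try (by apply/eqP; rewrite /B in pB *; lia).
    case: (eqVneq p (E + i)) => [->|ne].
      by rewrite /f1 /upd eqxx /ftape addnS leqnn.
    rewrite f1E // /ftape.
    have -> : (p < E + i.+1) = (p < E + i) by move/eqP: ne; lia.
    have -> : p == E + size z = ~~ (p < E + size z).
      by rewrite -/n; move: pB; rewrite /B; lia.
    by case: (p < E + i); case: (p < E + size z).
  have -> : p = B + (p - B) by lia.
  move: (p - B) => j; case: (ltnP j S) => jS.
    rewrite ftape_adv // fill_slot //.
    rewrite /f3 /f2 /upd -addnS !eqn_add2l.
    case: (eqVneq j (slot i).+1) => [->|_]; first by rewrite (gtn_eqF (ltnSn _)).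
    by case: eqP => // _; rewrite f1adv.
  have oob k : ftape k (B + j) = if B + j < E + k then None else None.
    rewrite /ftape; case: ifP => // _.
    have -> : B + j < E + size z = false by rewrite -/n /B; lia.
    have -> : B + j == E + size z = false by rewrite -/n /B; apply/eqP; lia.
    by rewrite -/n -/B addKn nth_default // size_map size_adv.
  rewrite f3E; try (by apply/eqP; lia).
  by rewrite f1E ?oob ?if_same //; apply/eqP; rewrite /B; lia.
exists (1 + ((n - i.+1) + (1 + ((slot i).+1 + (1 + (1 + (slot i + (1 + ((n - i.+1) + 1))))))))).
  by lia.
by rewrite !iterD s1 s2 s3 s4 s5 s6 s7 s8 s9 s10 fE.
Qed.

Lemma fill_all i b : i <= n ->
  exists t b', t <= i * (2 * n + 2 * S + 4) /\
  iter t gs (ctl 0 b, ftape 0, E) = (ctl 0 b', ftape i, E + i).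
Proof.
elim: i => [_|i IH lt]; first by exists 0, b; rewrite addn0.
have [t [b1 [le e]]] := IH (ltnW lt).
have [t' le' e'] := fill_round b1 lt.
exists (t' + t), (nth false z i); split; first by rewrite mulSn leq_add.
by rewrite iterD e e'.
Qed.

Lemma ftape_start : ftape 0 = tape_at E (encode_pair z (adv 0)).
Proof.
apply: functional_extensionality => p; rewrite /ftape /tape_at addn0; case: ltnP => // h.
rewrite /encode_pair nth_cat size_map.
have -> : (p - E < size z) = (p < E + size z) by lia.
case: ifP => h2; first by rewrite (nth_map false) //; lia.
have -> : (p == E + size z) = (p - E - size z == 0) by lia.
case e : (p - E - size z) => [|k] //=; congr nth; lia.
Qed.

(** The whole input has been erased, so what remains is an initial tape of [M], shifted to the
    right. *)
Lemma ftape_end : ftape n = tape_at B (encode (adv n)).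
Proof.
apply: functional_extensionality => p; rewrite /ftape /tape_at /B ltnS (leq_eqVlt p).
case: (eqVneq p (E + n)) => [->|ne] /=; first by rewrite !ltnn.
by case: ltnP => // h; rewrite ltnNge -/n h /= (negbTE ne).
Qed.

Lemma fill_then_run T : 
  exists2 t, t <= n * (2 * n + 2 * S + 4) + 1 &
  iter (T + t) gs (ctl 0 false, tape_at E (encode_pair z (adv 0)), E) =
  let: (q', f', p') := iter T (@mstep M) (tm_start M, tape_at B (encode (adv n)), B) in
  (inl q', f', p').
Proof.
have [t [b [le e]]] := fill_all false (leqnn n).
exists (1 + t); first by rewrite addnC leq_add2r.
rewrite iterD -ftape_start iterD e -inl_iter; congr iter.
rewrite [iter 1 _ _]ctl_step // ftape_border //= -ftape_end; congr (_, _, _).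
by rewrite -{2}(upd_id (ftape n) (E + n)) ftape_border.
Qed.

End Fill.

Lemma filler_correct z (adv : nat -> seq bool) (slot : nat -> nat) S T T' :
  (forall i, size (adv i) = S) ->
  (forall i, i < size z -> odd (slot i) = false) ->
  (forall i, i < size z -> (slot i).+1 < S) ->
  (forall i j, i < size z -> j < slot i -> odd j = false -> nth false (adv i) j = false) ->
  (forall i, i < size z -> nth false (adv i) (slot i) = true) ->
  (forall i j, i < size z -> nth false (adv i.+1) j =
    if j == slot i then false else if j == (slot i).+1 then nth false z i else nth false (adv i) j) ->
  halted (cstate (run M T (encode (adv (size z))))) ->
  T + size z * (2 * size z + 2 * S + 4) + 1 <= T' ->
  let cf := run filler T' (encode_pair z (adv 0)) in
  halted (cstate cf) /\ coutput cf = coutput (run M T (encode (adv (size z)))).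
Proof.
move=> h1 h2 h3 h4 h5 h6 hM le cf.
have [t let_ e] := fill_then_run T' h1 h2 h3 h4 h5 h6 T.
have tT : T + t <= T' by lia.
(* [M] starts behind the erased input and the separator, [size z + 1] cells to the right of the
   start of the filler. *)
have B_T : T <= (T' + size z).+1 by lia.
have rM := @run_rep M _ _ (encode (adv (size z))) B_T.
have hM' := hM; rewrite (rep_state rM) in hM'.
have rF := @run_rep filler _ _ (encode_pair z (adv 0)) (leqnn T').
have := mkTM_iter fdelta (ctl 0 false) (inl (tm_acc M)) (inl (tm_rej M)) T' (ctl 0 false)
  (tape_at T' (encode_pair z (adv 0))) T'.
have eT : iter T' gs (ctl 0 false, tape_at T' (encode_pair z (adv 0)), T')
   = let: (q', f', p') := iter T (@mstep M) (tm_start M, tape_at (T' + size z).+1 (encode (adv (size z))), (T' + size z).+1) in (inl q', f', p').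
  rewrite -e; apply: iter_fstep_halted_le tT _; rewrite e.
  by case: (iter T _ _) hM' => [[q f] p].
rewrite eT; move: rM hM'; case: (iter T _ _) => [[q f] p] rM hM' E.
rewrite -[tm_start filler]/(enc _) E in rF.
split; last exact: (rep_output rF rM).
rewrite /cf (rep_state rF) /= /halted /= !(can_eq (decK (ctl 0 false))).
exact: hM'.
Qed.

End Filler.

(** * Circuits for bounded computations *)

Section Circuits.
Variable n : nat.

Definition wires (gs : seq gate) (x : seq bool) : seq bool :=
  foldl (fun vals g => rcons vals (gate_val vals g)) x gs.

Lemma size_wires gs x : size (wires gs x) = size x + size gs.
Proof.
elim: gs x => [|g gs IH] x /=; first by rewrite addn0.
by rewrite IH size_rcons addSnnS.
Qed.

Lemma wires_cat gs gs' x : wires (gs ++ gs') x = wires gs' (wires gs x).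
Proof. exact: foldl_cat. Qed.

Lemma nth_wires gs x j : j < size x -> nth false (wires gs x) j = nth false x j.
Proof.
elim: gs x => //= g gs IH x lt; rewrite IH; last by rewrite size_rcons ltnS ltnW.
by rewrite nth_rcons lt.
Qed.

Definition avail (gs : seq gate) (F : seq bool -> bool) : Prop :=
  exists2 j, j < n + size gs & forall x, size x = n -> nth false (wires gs x) j = F x.

Lemma avail_cat gs gs' F : avail gs F -> avail (gs ++ gs') F.
Proof.
move=> [j lt h]; exists j; first by rewrite size_cat addnA ltn_addr.
by move=> x sx; rewrite wires_cat nth_wires ?h // size_wires sx.
Qed.

Lemma avail_ext gs F G : (forall x, size x = n -> F x = G x) -> avail gs F -> avail gs G.
Proof. by move=> e [j lt h]; exists j => // x sx; rewrite h // e. Qed.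

Lemma avail_gate gs g F :
  (forall x, size x = n -> gate_val (wires gs x) g = F x) -> avail (rcons gs g) F.
Proof.
move=> h; exists (n + size gs); first by rewrite size_rcons addnS.
move=> x sx; rewrite -cats1 wires_cat /= nth_rcons size_wires sx ltnn eqxx; exact: h.
Qed.

Lemma nth_wires_oob gs x : size x = n -> nth false (wires gs x) (n + size gs) = false.
Proof. by move=> sx; rewrite nth_default // size_wires sx. Qed.

(* A gate may read a wire that does not exist yet, which yields the constant [false]. *)
Lemma avail_const gs b : exists2 gs', size gs' <= 1 & avail (gs ++ gs') (fun _ => b).
Proof.
case: b; [exists [:: GNot (n + size gs)] | exists [:: GAnd (n + size gs) (n + size gs)]] => //;
  by rewrite cats1; apply: avail_gate => x sx /=; rewrite nth_wires_oob.
Qed.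

Lemma avail_not gs F : avail gs F -> exists2 gs', size gs' <= 1 & avail (gs ++ gs') (fun x => ~~ F x).
Proof.
move=> [j lt h]; exists [:: GNot j] => //; rewrite cats1; apply: avail_gate => x sx /=.
by rewrite h.
Qed.

Lemma avail_input gs j : j < n -> avail gs (fun x => nth false x j).
Proof.
by move=> lt; exists j; [rewrite ltn_addr | move=> x sx; rewrite nth_wires ?sx].
Qed.

Section Formulas.
Variable V : Type.

(** The variables stand for wires computed earlier and cost nothing, so in a sequence of layers the
    sizes add up instead of multiplying. *)
Inductive form := FVar of V | FFalse | FNot of form | FAnd of form & form | FOr of form & form.

Fixpoint feval (F : V -> seq bool -> bool) (f : form) (x : seq bool) : bool :=
  match f with
  | FVar v => F v x | FFalse => false | FNot g => ~~ feval F g x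
  | FAnd g h => feval F g x && feval F h x | FOr g h => feval F g x || feval F h x
  end.

Fixpoint fsize (f : form) : nat :=
  match f with
  | FVar _ => 0 | FFalse => 1 | FNot g => (fsize g).+1
  | FAnd g h => (fsize g + fsize h).+1 | FOr g h => (fsize g + fsize h).+1
  end.

Fixpoint fok (P : pred V) (f : form) : bool :=
  match f with
  | FVar v => P v | FFalse => true | FNot g => fok P g
  | FAnd g h => fok P g && fok P h | FOr g h => fok P g && fok P h
  end.

Definition FOrs (s : seq form) : form := foldr FOr FFalse s.
Definition FAnds (s : seq form) : form := foldr FAnd (FNot FFalse) s.

Lemma feval_FOrs F s x : feval F (FOrs s) x = has (fun f => feval F f x) s.
Proof. by elim: s => //= f s ->. Qed.

Lemma feval_FAnds F s x : feval F (FAnds s) x = all (fun f => feval F f x) s.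
Proof. by elim: s => //= f s ->. Qed.

Lemma fok_FOrs P s : fok P (FOrs s) = all (fok P) s.
Proof. by elim: s => //= f s ->. Qed.

Lemma fok_FAnds P s : fok P (FAnds s) = all (fok P) s.
Proof. by elim: s => //= f s ->. Qed.

Lemma fsize_FOrs_map (A : Type) (g : A -> form) c s :
  (forall u, fsize (g u) <= c) -> fsize (FOrs [seq g u | u <- s]) <= (c.+1 * size s).+1.
Proof. by move=> h; elim: s => //= u s IH; have := h u; rewrite mulnS; lia. Qed.

Lemma fsize_FAnds_map (A : Type) (g : A -> form) c s :
  (forall u, fsize (g u) <= c) -> fsize (FAnds [seq g u | u <- s]) <= (c.+1 * size s).+2.
Proof. by move=> h; elim: s => //= u s IH; have := h u; rewrite mulnS; lia. Qed.

Lemma form_gates gs F (P : pred V) f : (forall v, P v -> avail gs (F v)) -> fok P f ->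
  exists2 gs', size gs' <= fsize f & avail (gs ++ gs') (feval F f).
Proof.
elim: f gs => [v||f IH|f IH1 g IH2|f IH1 g IH2] /= gs hP.
- by move=> /hP h; exists [::]; rewrite ?cats0.
- by have [gs' le h] := avail_const gs false; exists gs'.
- move=> /(IH gs hP)[g1 le h]; have [g2 le2 h2] := avail_not h.
  by exists (g1 ++ g2); [rewrite size_cat; lia | rewrite catA].
- move=> /andP[/(IH1 gs hP)[g1 le1 h1] /(IH2 (gs ++ g1))[v /hP|g2 le2 [j2 lt2 h2]]].
    exact: avail_cat.
  have [j1 lt1 {}h1] := avail_cat g2 h1.
  exists (g1 ++ rcons g2 (GAnd j1 j2)); first by rewrite size_cat size_rcons; lia.
  by rewrite catA -rcons_cat; apply: avail_gate => x sx /=; rewrite h1 // h2.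
- move=> /andP[/(IH1 gs hP)[g1 le1 h1] /(IH2 (gs ++ g1))[v /hP|g2 le2 [j2 lt2 h2]]].
    exact: avail_cat.
  have [j1 lt1 {}h1] := avail_cat g2 h1.
  exists (g1 ++ rcons g2 (GOr j1 j2)); first by rewrite size_cat size_rcons; lia.
  by rewrite catA -rcons_cat; apply: avail_gate => x sx /=; rewrite h1 // h2.
Qed.

End Formulas.

(** The hypothesis allows arbitrary further gates [gs'] because those for the other elements of [s]
    may already have been inserted. *)
Lemma many_gates (T : eqType) (s : seq T) (G : T -> seq bool -> bool) c gs :
  (forall t gs', t \in s -> exists2 gs'', size gs'' <= c & avail ((gs ++ gs') ++ gs'') (G t)) ->
  exists2 gs', size gs' <= c * size s & forall t, t \in s -> avail (gs ++ gs') (G t).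
Proof.
elim: s => [|t s IH] h; first by exists [::] => // t; rewrite in_nil.
have [|g1 le1 h1] := IH.
  by move=> u gs' us; apply: h; rewrite inE us orbT.
have [g2 le2 h2] := h t g1 (mem_head _ _).
exists (g1 ++ g2); first by rewrite size_cat /= mulnS; lia.
move=> u; rewrite inE catA => /orP[/eqP ->|us] //.
by apply: avail_cat; apply: h1.
Qed.

(** * The tableau of a bounded run *)

Section Tableau.
Variables (M : TM) (T l : nat) (tp : seq bool -> nat -> sym).
Notation Q := 'I_(tm_Q M).+1.

(** The head starts at [T] and stays within [2 * T]; testing an output of length at most [l] there,
    with its final blank, reads cells up to [2 * T + l]. *)
Definition tableau_width := 2 * T + l + 2.
Hypothesis projection : forall p, p < tableau_width ->
  (exists a, forall x, size x = n -> tp x p = a) \/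
  (exists2 j, j < n & forall x, size x = n -> tp x p = Some (nth false x j)).

Definition config_at (t : nat) (x : seq bool) := iter t (@mstep M) (tm_start M, tp x, T).

Definition var : eqType := ((nat * Q) + (nat * sym))%type.

Definition tval (t : nat) (v : var) (x : seq bool) : bool :=
  match v with
  | inl (p, q) => ((config_at t x).2 == p) && ((config_at t x).1.1 == q)
  | inr (p, a) => (config_at t x).1.2 p == a
  end.

Definition inW : pred var := fun v => match v with inl (p, _) => p < tableau_width | inr (p, _) => p < tableau_width end.

Definition syms : seq sym := [:: None; Some true; Some false].
Lemma mem_syms a : a \in syms. Proof. by case: a => [[|]|]. Qed.

Definition vars : seq var :=
  [seq inl (p, q) | p <- iota 0 tableau_width, q <- enum 'I_(tm_Q M).+1] ++
  [seq inr (p, a) | p <- iota 0 tableau_width, a <- syms].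

Lemma mem_vars (v : var) : (v \in vars) = inW v.
Proof.
rewrite mem_cat; case: v => [[p q]|[p a]]; rewrite [inW _]/=.
- apply/orP/idP => [[/allpairsP[[p' q'] [/= h _ [-> _]]]|/allpairsP[[p' a'] [/= _ _ //]]]|h].
    by move: h; rewrite mem_iota.
  by left; apply/allpairsP; exists (p, q); rewrite mem_iota mem_enum.
- apply/orP/idP => [[/allpairsP[[p' q'] [/= _ _ //]]|/allpairsP[[p' a'] [/= h _ [-> _]]]]|h].
    by move: h; rewrite mem_iota.
  by right; apply/allpairsP; exists (p, a); rewrite mem_iota mem_syms.
Qed.

Lemma size_vars : size vars = tableau_width * ((tm_Q M).+1 + 3).
Proof. by rewrite size_cat !size_allpairs size_iota size_enum_ord mulnDr. Qed.

Definition lmove (p : nat) (q : Q) (b : sym) : nat * Q :=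
  if halted q then (p, q) else let: (q', w, m) := tm_delta q b in (shift_head m p, q').

Definition lwrite (q : Q) (b : sym) : sym :=
  if halted q then b else (tm_delta q b).1.2.

Lemma mstepE q f p : @mstep M (q, f, p) =
  ((lmove p q (f p)).2, upd f p (lwrite q (f p)), (lmove p q (f p)).1).
Proof.
rewrite /mstep /= /lmove /lwrite /halted; case: ifP => _ /=.
  congr (_, _, _); apply: functional_extensionality => i; rewrite /upd.
  by case: eqP => // ->.
by case: (tm_delta q (f p)) => [[q' w] m].
Qed.

Definition reads : seq (Q * sym) := [seq (q0, b) | q0 <- enum 'I_(tm_Q M).+1, b <- syms].
(** The head moves by at most one cell. For [p = 0] the positions are 0, 1, 2, and the condition on
    [lmove] in [fhead] discards the last. *)
Definition local_reads (p : nat) : seq (nat * (Q * sym)) :=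
  [seq (p', u) | p' <- iota p.-1 3, u <- reads].
Arguments reads : simpl never.
Arguments local_reads : simpl never.

Lemma mem_reads u : u \in reads.
Proof. by apply/allpairsP; exists u; rewrite mem_enum mem_syms; case: u. Qed.

Definition fhead (p : nat) (q : Q) : form var :=
  FOrs [seq FAnd (FVar (inl (u.1, u.2.1) : var)) (FVar (inr (u.1, u.2.2) : var))
       | u <- local_reads p
       & (u.1 < tableau_width) && (lmove u.1 u.2.1 u.2.2 == (p, q))].

Definition fcell (p : nat) (a : sym) : form var :=
  FOr (FOrs [seq FAnd (FVar (inl (p, u.1) : var)) (FVar (inr (p, u.2) : var))
       | u <- reads & lwrite u.1 u.2 == a])
   (FAnd (FVar (inr (p, a) : var)) (FNot (FOrs [seq FVar (inl (p, q) : var) | q <- enum 'I_(tm_Q M).+1]))).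

Definition fnext (v : var) : form var :=
  match v with inl (p, q) => fhead p q | inr (p, a) => fcell p a end.

(** A head formula has two gates for every combination of a state, one of three symbols and one of
    three positions, hence 18 per state; the bound for cell formulas is smaller. *)
Definition update_cost : nat := 18 * (tm_Q M).+1 + 7.

Lemma fsize_fnext v : fsize (fnext v) <= update_cost.
Proof.
have sz : size reads = 3 * (tm_Q M).+1.
  by rewrite size_allpairs size_enum_ord mulnC.
case: v => [[p q]|[p a]]; rewrite /fnext /fhead /fcell.
  apply: leq_trans (fsize_FOrs_map (c := 1) _ _) _ => [u //|].
  rewrite size_filter /update_cost.
  apply: (@leq_trans (2 * (3 * (3 * (tm_Q M).+1))).+1); last lia.
  by rewrite ltnS leq_mul2l (leq_trans (count_size _ _)) // size_allpairs sz size_iota.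
set f1 := FOrs _; set f2 := FOrs _.
have h1 : fsize f1 <= (2 * (3 * (tm_Q M).+1)).+1.
  apply: leq_trans (fsize_FOrs_map (c := 1) _ _) _ => [u //|].
  by rewrite ltnS leq_mul2l size_filter (leq_trans (count_size _ _)) // sz.
have h2 : fsize f2 <= (1 * (tm_Q M).+1).+1.
  apply: leq_trans (fsize_FOrs_map (c := 0) _ _) _ => [u //|].
  by rewrite size_enum_ord.
by rewrite /= /update_cost; move: h1 h2; move: (fsize f1) (fsize f2) => u1 u2 *; lia.
Qed.

Lemma fok_fnext v : inW v -> fok inW (fnext v).
Proof.
case: v => [[p q]|[p a]] pW; rewrite /= in pW; rewrite /fnext /fhead /fcell.
  rewrite fok_FOrs all_map; apply/allP => [[p' [q0 b]]]; rewrite mem_filter => /andP[/andP[/= h _] _].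
  by rewrite h.
set f1 := FOrs _; set f2 := FOrs _; rewrite /= pW /= /f1 /f2 !fok_FOrs !all_map.
by apply/andP; split; apply/allP => u _ /=; rewrite ?pW.
Qed.

Lemma head_bound t x : t <= T -> (config_at t x).2 <= 2 * T.
Proof.
move=> le; have [h _] := iter_fstep_head (@tm_delta M) (tm_acc M) (tm_rej M) t (tm_start M, tp x, T).
by apply: (leq_trans h); rewrite /=; lia.
Qed.

Lemma feval_fnext t v x : t < T -> feval (tval t) (fnext v) x = tval t.+1 v x.
Proof.
move=> tT; have hb := head_bound x (ltnW tT).
rewrite [RHS]/tval [config_at t.+1 x]/(mstep (config_at t x)).
case E: (config_at t x) hb => [[q0 f] p0] hb; rewrite -/(@mstep M) mstepE; rewrite /= in hb.
have p0W : p0 < tableau_width by rewrite /tableau_width; lia.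
have near : lmove p0 q0 (f p0) = ((lmove p0 q0 (f p0)).1, (lmove p0 q0 (f p0)).2) by case: (lmove _ _ _).
case: v => [[p q]|[p a]]; rewrite /fnext /fhead /fcell [RHS]/=.
- rewrite feval_FOrs has_map; apply/hasP/andP => [[[p' [q' b]]]|[/eqP e1 /eqP e2]] /=.
    rewrite mem_filter /= E /= => /andP[/andP[_ /eqP e] _] /andP[/andP[/eqP -> /eqP ->] /eqP ->].
    by rewrite e.
  exists (p0, (q0, f p0)); last by rewrite /= E /= !eqxx.
  rewrite mem_filter; apply/andP; split; first by rewrite [_.1]/= [_.2]/= p0W near e1 e2 eqxx.
  apply/allpairsP; exists (p0, (q0, f p0)); split; [|exact: mem_reads|by []].
  rewrite [_.1]/= mem_iota -e1 /lmove.
  by case: ifP => _ /=; [lia | case: (tm_delta _ _) => [[? ?] []] /=; lia].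
- set f1 := FOrs _; set f2 := FOrs _; rewrite /= E /upd /f1 /f2 !feval_FOrs.
  rewrite (_ : has _ [seq FVar _ | _ <- enum _] = (p0 == p)); last first.
    rewrite has_map.
    apply/hasP/eqP => [[q _]|<-]; first by rewrite /= E /= => /andP[/eqP].
    by exists q0; rewrite ?mem_enum //= E /= !eqxx.
  rewrite (_ : has _ [seq FAnd _ _ | _ <- _] = (p0 == p) && (lwrite q0 (f p0) == a)); last first.
    rewrite has_map.
    apply/hasP/andP => [[[q b]]|[/eqP <- h]].
      rewrite mem_filter /= E /= => /andP[/eqP e _] /andP[/andP[/eqP e1 /eqP e2] /eqP e3].
      by rewrite e1 e2 e3 e.
    exists (q0, f p0); first by rewrite mem_filter /= h mem_reads.
    by rewrite /= E /= !eqxx.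
  by rewrite (eq_sym p); case: eqP => [->|_] //=; rewrite ?andbF ?orbF ?andbT.
Qed.

Lemma tableau0 gs : exists2 gs', size gs' <= update_cost * size vars &
  forall v, inW v -> avail (gs ++ gs') (tval 0 v).
Proof.
have [|gs' le h] := @many_gates _ vars (tval 0) update_cost gs; last first.
  by exists gs' => // v; rewrite -mem_vars; apply: h.
have c1 : 1 <= update_cost by rewrite /update_cost; lia.
move=> v gs'; rewrite mem_vars; move: (gs ++ gs') => {gs gs'} gs.
have K b (F : seq bool -> bool) : (forall x, size x = n -> F x = b) ->
    exists2 gs'', size gs'' <= update_cost & avail (gs ++ gs'') F.
  move=> e; have [g le h] := avail_const gs b; exists g; first exact: leq_trans le c1.
  by apply: avail_ext h => x sx; rewrite /= e.
case: v => [[p q]|[p a]] /= pW; first by apply: (K ((T == p) && (tm_start M == q))).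
case: (projection pW) => [[c e]|[j jn e]].
  by apply: (K (c == a)) => x sx; rewrite /= e.
case: a => [[|]|].
- exists [::] => //; rewrite cats0; apply: avail_ext (avail_input gs jn) => x sx.
  by rewrite /= e //; case: nth.
- have [g le h] := avail_not (avail_input gs jn); exists g; first exact: leq_trans le c1.
  by apply: avail_ext h => x sx; rewrite /= e //; case: nth.
- by apply: (K false) => x sx; rewrite /= e.
Qed.

Lemma tableau gs t : t <= T -> exists2 gs', size gs' <= t.+1 * (update_cost * size vars) &
  forall v, inW v -> avail (gs ++ gs') (tval t v).
Proof.
elim: t => [_|t IH lt]; first by rewrite mul1n; apply: tableau0.
have [g1 le1 h1] := IH (ltnW lt).
have [|g2 le2 h2] := @many_gates _ vars (tval t.+1) update_cost (gs ++ g1).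
  move=> v g; rewrite mem_vars => vW.
  have [|g3 le3 h3] := @form_gates _ ((gs ++ g1) ++ g) (tval t) inW (fnext v) _ (fok_fnext vW).
    by move=> u uW; apply: avail_cat; apply: h1.
  exists g3; first exact: leq_trans le3 (fsize_fnext v).
  by apply: avail_ext h3 => x sx; apply: feval_fnext.
exists (g1 ++ g2); first by rewrite size_cat mulSn; lia.
by move=> v vW; rewrite catA; apply: h2; rewrite mem_vars.
Qed.

Definition fcells (p : nat) (a : seq bool) : form var :=
  FAnd (FAnds [seq FVar (inr (p + k, Some (nth false a k)) : var) | k <- iota 0 (size a)])
    (FVar (inr (p + size a, None) : var)).

(** The final head position depends on the input, so the disjunction runs over all positions that it
    can have. *)
Definition fout (s : seq (seq bool)) : form var :=
  FOrs [seq FAnd (FOrs [seq FVar (inl (u.1, q) : var) | q <- enum 'I_(tm_Q M).+1]) (fcells u.1 u.2)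
       | u <- [seq (p, a) | p <- iota 0 (2 * T).+1, a <- s]].

Lemma fsize_fout s : all (fun a => size a <= l) s ->
  fsize (fout s) <= ((tm_Q M).+1 + l + 6) * ((2 * T).+1 * size s) + 1.
Proof.
move=> hs; rewrite addn1 /fout.
have -> : (2 * T).+1 * size s = size [seq (p, a) | p <- iota 0 (2 * T).+1, a <- s].
  by rewrite size_allpairs size_iota.
have : all (fun u : nat * seq bool => size u.2 <= l) [seq (p, a) | p <- iota 0 (2 * T).+1, a <- s].
  by apply/allP => _ /allpairsP[[p a] [/= _ ain ->]] /=; apply: (allP hs).
elim: [seq _ | _ <- _, _ <- _] => //= -[p a] us IH /andP[/= al /IH].
set f1 := FOrs [seq FVar _ | _ <- _]; set f2 := FAnds _.
have h1 : fsize f1 <= (1 * (tm_Q M).+1).+1.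
  apply: leq_trans (fsize_FOrs_map (c := 0) _ _) _ => [u //|].
  by rewrite size_enum_ord.
have h2 : fsize f2 <= (1 * size a).+2.
  apply: leq_trans (fsize_FAnds_map (c := 0) _ _) _ => [u //|].
  by rewrite size_iota.
rewrite mulnS; move: h1 h2 al; move: (fsize f1) (fsize f2) => u1 u2.
by move: (fsize (FOrs _)) (_ * size us) => u3 u4; lia.
Qed.

Lemma fok_fout s : all (fun a => size a <= l) s -> fok inW (fout s).
Proof.
move=> hs; rewrite fok_FOrs all_map; apply/allP => [[p a] /allpairsP[[p' a'] [pin ain [-> ->]]]].
rewrite /= in ain.
have al := allP hs _ ain; rewrite mem_iota /= in pin.
rewrite /preim /= fok_FOrs fok_FAnds !all_map; apply/and3P; split.
- by apply/allP => q _ /=; rewrite /tableau_width; lia.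
- by apply/allP => k; rewrite mem_iota => kin /=; rewrite /tableau_width; lia.
- by rewrite /tableau_width; lia.
Qed.

Lemma feval_fout s x : feval (tval T) (fout s) x =
  has (fun a => all (fun k => (config_at T x).1.2 ((config_at T x).2 + k) == Some (nth false a k)) (iota 0 (size a))
     && ((config_at T x).1.2 ((config_at T x).2 + size a) == None)) s.
Proof.
have hb := head_bound x (leqnn T).
rewrite feval_FOrs has_map; case E: (config_at T x) hb => [[q0 f] p0] hb; rewrite /= in hb.
apply/hasP/hasP => [[[p a] /allpairsP[[p' a'] [pin ain [-> ->]]]]|[a ain /andP[h1 h2]]].
  rewrite /= feval_FOrs feval_FAnds has_map all_map => /and3P[/hasP[q _]].
  rewrite /= E /= => /andP[/eqP -> _] h1 h2; exists a' => //; rewrite h2 andbT.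
  by apply: sub_all h1 => k /=; rewrite E.
exists (p0, a); first by apply/allpairsP; exists (p0, a); rewrite mem_iota.
rewrite /= feval_FOrs feval_FAnds has_map all_map E /= h2 andbT; apply/andP; split.
  by apply/hasP; exists q0; rewrite ?mem_enum //= E /= !eqxx.
by apply: sub_all h1 => k /=; rewrite E.
Qed.

Lemma output_gates gs s : all (fun a => size a <= l) s ->
  exists2 gs', size gs' <= T.+1 * (update_cost * (tableau_width * ((tm_Q M).+1 + 3)))
      + ((tm_Q M).+1 + l + 6) * ((2 * T).+1 * size s) + 1 &
  avail (gs ++ gs') (fun x =>
    has (fun a => all (fun k => (config_at T x).1.2 ((config_at T x).2 + k) == Some (nth false a k)) (iota 0 (size a))
     && ((config_at T x).1.2 ((config_at T x).2 + size a) == None)) s).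
Proof.
move=> hs; have [g1 le1 h1] := tableau gs (leqnn T).
have [|g2 le2 h2] := @form_gates _ (gs ++ g1) (tval T) inW (fout s) _ (fok_fout hs) => //.
exists (g1 ++ g2).
  by rewrite size_cat -addnA leq_add // -?size_vars // (leq_trans le2) // fsize_fout.
by rewrite catA; apply: avail_ext h2 => x sx; apply: feval_fout.
Qed.

End Tableau.
End Circuits.

(** * Covers, finite tables and polynomial bounds *)

(** Fixing all but one component of an instance leaves bits of this kind, so that building the
    instance needs no gates beyond constants and negations. *)
Definition bit_projection (n S : nat) (inp : seq bool -> seq bool) : Prop :=
  (forall x, size x = n -> size (inp x) = S) /\
  forall k, k < S -> (exists b, forall x, size x = n -> nth false (inp x) k = b) \/
    (exists2 j, j < n & forall x, size x = n -> nth false (inp x) k = nth false x j).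

Definition hit_cost (M : TM) (T l N : nat) : nat :=
  T.+1 * (update_cost M * (tableau_width T l * ((tm_Q M).+1 + 3)))
      + ((tm_Q M).+1 + l + 6) * ((2 * T).+1 * N) + 1.

Lemma tape_projection n S T l inp : bit_projection n S inp ->
  forall p, p < tableau_width T l ->
  (exists a, forall x, size x = n -> tape_at T (encode (inp x)) p = a) \/
  (exists2 j, j < n & forall x, size x = n -> tape_at T (encode (inp x)) p = Some (nth false x j)).
Proof.
move=> [sz pr] p _; rewrite /tape_at; case: (ltnP p T) => h; first by left; exists None.
case: (ltnP (p - T) S) => hS.
  case: (pr _ hS) => [[b e]|[j jn e]]; [left; exists (Some b) | right; exists j => //];
    by move=> x sx; rewrite (nth_map false) ?sz ?e.
by left; exists None => x sx; rewrite nth_default // size_map sz.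
Qed.

(** In the application [neg] is true when a hit certifies that [x] is outside [L], and false when it
    certifies that [x] is in [L]. *)
Lemma hit_circuit n S M T l N r (inp : nat -> seq bool -> seq bool) (s : nat -> seq (seq bool)) neg :
  (forall i, i < r -> bit_projection n S (inp i)) ->
  (forall i, i < r -> size (s i) <= N /\ all (fun a => size a <= l) (s i)) ->
  exists2 C : circuit, circ_size C <= hit_cost M T l N * r + r + 2 &
  forall x, size x = n -> circ_eval C x =
    neg (+) has (fun i => has (fun a => coutput (run M T (encode (inp i x))) == a) (s i)) (iota 0 r).
Proof.
move=> hp hs.
pose G i (x : seq bool) := has (fun a => coutput (run M T (encode (inp i x))) == a) (s i).
have [|g1 le1 h1] := @many_gates n _ (iota 0 r) G (hit_cost M T l N) [::].
  move=> i g; rewrite mem_iota /= add0n => ir.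
  have [hN hl] := hs i ir.
  have [g2 le2 h2] := output_gates M (tp := fun x => tape_at T (encode (inp i x)))
    (tape_projection (l := l) (hp i ir)) ([::] ++ g) hl.
  exists g2.
    apply: leq_trans le2 _; rewrite /hit_cost leq_add2r leq_add2l leq_mul2l.
    by rewrite leq_mul2l hN !orbT.
  apply: avail_ext h2 => x sx; apply: eq_has => a.
  have rM := @run_rep M _ _ (encode (inp i x)) (leqnn T).
  rewrite /config_at; case: (iter T _ _) rM => [[q f] p] rM.
  by rewrite (output_nth a rM).
have [||g2 le2 h2] := @form_gates n nat ([::] ++ g1) G (fun i => i < r)
    (FOrs [seq FVar i | i <- iota 0 r]).
- by move=> i ir; apply: h1; rewrite mem_iota.
- by rewrite fok_FOrs all_map; apply/allP => i; rewrite mem_iota.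
have e2 x : feval G (FOrs [seq FVar i | i <- iota 0 r]) x = has (fun i => G i x) (iota 0 r).
  by rewrite feval_FOrs has_map.
have le3 : size g2 <= r + 1.
  apply: (leq_trans le2); apply: leq_trans (fsize_FOrs_map (c := 0) _ _) _ => [u //|].
  by rewrite size_iota mul1n addn1.
rewrite size_iota in le1.
case: neg.
  have [g3 leg3 [j _ h3]] := avail_not h2.
  exists {| c_gates := (([::] ++ g1) ++ g2) ++ g3; c_out := j |}.
    by rewrite /circ_size /= !size_cat; lia.
  by move=> x sx; rewrite /circ_eval /= -/(wires _ x) h3 // e2.
have [j _ h3] := h2.
exists {| c_gates := ([::] ++ g1) ++ g2; c_out := j |}.
  by rewrite /circ_size /= !size_cat; lia.
by move=> x sx; rewrite /circ_eval /= -/(wires _ x) h3 // e2.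
Qed.

(** Every chosen [x] covers at least half of what is left, so fewer than [2 ^ m] elements are
    exhausted in [m] rounds. *)
Lemma greedy_cover (X Y : eqType) (P : X -> Prop) (R : X -> Y -> bool) m (s : seq Y) :
  (forall s', s' <> [::] -> {subset s' <= s} -> exists2 x, P x & size s' <= 2 * count (R x) s') ->
  size s < expn 2 m ->
  exists xs : seq X, [/\ size xs <= m, forall x, x \in xs -> P x &
    forall y, y \in s -> has (fun x => R x y) xs].
Proof.
elim: m s => [|m IH] s h lt.
  by exists [::]; split=> // y; rewrite (size0nil (s := s)) //; move: lt; rewrite expn0; lia.
have [->|sn] := eqVneq s [::]; first by exists [::].
have [|//|x Px hx] := h s; first exact/eqP.
have [s' s's||xs [sz hP hR]] := IH [seq y <- s | ~~ R x y].
- by move=> sub; apply: h => // y /sub; rewrite mem_filter => /andP[].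
- rewrite size_filter -[count _ s]/(count (predC (R x)) s).
  by have := count_predC (R x) s; move: lt hx; rewrite expnS; lia.
exists (x :: xs); split => //.
- by move=> u; rewrite inE => /orP[/eqP ->|/hP].
- move=> y ys /=; case E: (R x y) => //=; apply: hR.
  by rewrite mem_filter E.
Qed.

Lemma sum_le_size (T : eqType) (w : seq T) F b :
  (forall y, y \in w -> F y <= b) -> \sum_(y <- w) F y <= size w * b.
Proof.
elim: w => [|y w IH] h; first by rewrite big_nil.
rewrite big_cons mulSn leq_add ?h ?mem_head // IH // => z zw.
by rewrite h // inE zw orbT.
Qed.

Lemma sum_ge_size (T : eqType) (w : seq T) F b :
  (forall y, y \in w -> b <= F y) -> size w * b <= \sum_(y <- w) F y.
Proof.
elim: w => [|y w IH] h; first by rewrite big_nil.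
rewrite big_cons mulSn leq_add ?h ?mem_head // IH // => z zw.
by rewrite h // inE zw orbT.
Qed.

(** A minimax theorem in greedy form: covers of logarithmic size replace mixed strategies. *)
Lemma cover_alternative (X Y : eqType) (Q Q' : X -> Y -> bool) m (sx : seq X) (sy : seq Y) :
  (forall x y, x \in sx -> y \in sy -> Q x y || Q' x y) ->
  size sx < expn 2 m -> size sy < expn 2 m ->
  (exists xs : seq X, [/\ size xs <= m, {subset xs <= sx} &
     forall y, y \in sy -> has (fun x => Q x y) xs]) \/
  (exists ys : seq Y, [/\ size ys <= m, {subset ys <= sy} &
     forall x, x \in sx -> has (fun y => Q' x y) ys]).
Proof.
move=> QQ' ltx lty.
have [h|h] := classic (forall s', s' <> [::] -> {subset s' <= sy} ->
   exists2 x, x \in sx & size s' <= 2 * count (Q x) s').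
  by left; apply: (greedy_cover (P := fun x => x \in sx)).
(* Otherwise some [w] is less than half covered by every [Q x], hence at least half covered by
   every [Q' x]; double counting then makes the elements of [w] greedily cover [sx]. *)
right; have {h} [w [wn wsub hw]] : exists w, [/\ w <> [::], {subset w <= sy} &
   forall x, x \in sx -> 2 * count (Q x) w < size w].
  have [w hw] := not_all_ex_not _ _ h; exists w.
  have [wn {}hw] := imply_to_and _ _ hw; have [wsub {}hw] := imply_to_and _ _ hw; split=> //.
  by move=> x xs; rewrite ltnNge; apply/negP => le; apply: hw; exists x.
have hw' x : x \in sx -> size w <= 2 * count (Q' x) w.
  move=> xs; have := hw x xs; have := count_predC (Q x) w.
  have : count (predC (Q x)) w <= count (Q' x) w.
    rewrite -!size_filter (@eq_in_filter _ _ (predI (predC (Q x)) (Q' x))).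
      by rewrite !size_filter; apply: sub_count => y /andP[].
    by move=> y yw /=; have := QQ' x y xs (wsub _ yw); case: (Q x y).
  by lia.
apply: (greedy_cover (P := fun y => y \in sy) (R := fun y x => Q' x y)) => // u un usub.
have [[y yw hy]|h] := classic (exists2 y, y \in w & size u <= 2 * count (fun x => Q' x y) u).
  by exists y => //; apply: wsub.
have {}h y : y \in w -> 2 * count (fun x => Q' x y) u < size u.
  by move=> yw; rewrite ltnNge; apply/negP => le; apply: h; exists y.
have s1 : \sum_(y <- w) 2 * count (fun x => Q' x y) u < size w * size u.
  case: w wn {wsub hw hw'} h => // y0 w _ h.
  rewrite big_cons /= mulSn -addSn; apply: leq_add; first by apply: h; rewrite mem_head.
  by apply: sum_le_size => y yw; apply: ltnW; apply: h; rewrite inE yw orbT.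
have s2 : size w * size u <= \sum_(x <- u) 2 * count (Q' x) w.
  by rewrite mulnC; apply: sum_ge_size => x xu; apply: hw'; apply: usub.
have e : \sum_(y <- w) 2 * count (fun x => Q' x y) u = \sum_(x <- u) 2 * count (Q' x) w.
  rewrite -!big_distrr /=; congr (2 * _).
  have cE (Z : Type) (p : pred Z) (v : seq Z) : count p v = \sum_(z <- v) p z.
    by elim: v => [|z v IH]; rewrite ?big_nil ?big_cons //= IH.
  rewrite (eq_bigr (fun y => \sum_(x <- u) Q' x y)) => [|y _]; last exact: cE.
  by rewrite exchange_big /=; apply: eq_bigr => x _; rewrite cE.
by move: s1; rewrite e ltnNge s2.
Qed.

Definition bit_strings (n : nat) : seq (seq bool) := [seq val t | t <- enum {: n.-tuple bool}].

Lemma mem_bit_strings n x : (x \in bit_strings n) = (size x == n).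
Proof.
apply/mapP/idP => [[t _ ->]|sx]; first by rewrite size_tuple.
by exists (Tuple sx); rewrite ?mem_enum.
Qed.

Lemma size_bit_strings n : size (bit_strings n) = expn 2 n.
Proof. by rewrite size_map -cardE card_tuple card_bool. Qed.

Definition short_strings (n : nat) : seq (seq bool) := flatten [seq bit_strings k | k <- iota 0 n.+1].

Lemma mem_short_strings n x : (x \in short_strings n) = (size x <= n).
Proof.
apply/flattenP/idP => [[s /mapP[k kin ->]]|le].
  by rewrite mem_bit_strings => /eqP ->; move: kin; rewrite mem_iota.
by exists (bit_strings (size x)); rewrite ?mem_bit_strings // map_f // mem_iota.
Qed.

Lemma size_short_strings n : size (short_strings n) <= expn 2 n.+1.
Proof.
rewrite /short_strings size_flatten /shape -map_comp.
rewrite (eq_map (g := expn 2)); last by move=> k /=; rewrite size_bit_strings.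
suff : sumn [seq expn 2 i | i <- iota 0 n.+1] < expn 2 n.+1 by apply: ltnW.
elim: (n.+1) => // k IH; rewrite -(addn1 k) iotaD map_cat sumn_cat /= addn0 add0n addn1 expnS.
by lia.
Qed.

(** One constant is both shift and exponent. The shift keeps the base positive, so the bound grows
    with [c] and two bounds can be merged into one. *)
Definition polyb (F : nat -> nat) : Prop := exists c, forall n, F n <= expn (n + c.+1) c.

Lemma polyb_le F G : (forall n, F n <= G n) -> polyb G -> polyb F.
Proof. by move=> le [c h]; exists c => n; apply: leq_trans (le n) (h n). Qed.

Lemma leq_expl a b c : a <= b -> expn a c <= expn b c.
Proof. by case: c => // c le; rewrite leq_exp2r. Qed.

Lemma polyb_mono n c e : c <= e -> expn (n + c.+1) c <= expn (n + e.+1) e.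
Proof.
move=> le; apply: (@leq_trans (expn (n + e.+1) c)); first by apply: leq_expl; rewrite leq_add2l.
by rewrite leq_pexp2l // addnS.
Qed.

Lemma polyb_const a : polyb (fun _ => a).
Proof.
exists a => n; case: a => // a; apply: ltnW.
by apply: (leq_trans (@ltn_expl 2 a.+1 isT)); apply: leq_expl; lia.
Qed.

Lemma polyb_id : polyb (fun n => n).
Proof. by exists 1 => n; rewrite expn1 leq_addr. Qed.

Lemma polyb_add F G : polyb F -> polyb G -> polyb (fun n => F n + G n).
Proof.
move=> [c hc] [d hd]; exists (c + d).+1 => n.
apply: leq_trans (leq_add (hc n) (hd n)) _.
apply: leq_trans (leq_add (polyb_mono n (leq_addr d c)) (polyb_mono n (leq_addl c d))) _.
rewrite addnn -mul2n expnS; apply: leq_mul; first lia.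
by apply: leq_expl; lia.
Qed.

Lemma polyb_mul F G : polyb F -> polyb G -> polyb (fun n => F n * G n).
Proof.
move=> [c hc] [d hd]; exists (c + d) => n; rewrite expnD.
apply: leq_mul; [apply: leq_trans (hc n) _ | apply: leq_trans (hd n) _];
  by apply: leq_expl; lia.
Qed.

Lemma polyb_pow F k : polyb F -> polyb (fun n => expn (F n) k).
Proof.
move=> hF; elim: k => [|k IH]; first by apply: polyb_le (polyb_const 1) => n; rewrite expn0.
by apply: polyb_le (polyb_mul hF IH) => n; rewrite expnS.
Qed.

Lemma polyb_pbound F c k : polyb F -> polyb (fun n => pbound c k (F n)).
Proof.
move=> hF.
apply: polyb_le (polyb_add (polyb_mul (polyb_const c) (polyb_pow k hF)) (polyb_const c)) => n.
by rewrite pboundE.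
Qed.

Lemma polyb_shift F a : polyb F -> polyb (fun n => F (n + a)).
Proof.
move=> [c hc]; exists (a + c) => n; apply: leq_trans (hc _) _.
apply: (@leq_trans (expn (n + (a + c).+1) c)); first by apply: leq_expl; lia.
by rewrite leq_pexp2l ?leq_addl // addnS.
Qed.

Lemma polyb_le_pbound F : polyb F -> exists c k, forall n, F n <= pbound c k n.
Proof.
move=> [c hc]; exists (expn c.+2 c), c => n; apply: leq_trans (hc n) _; rewrite pboundE.
case: n => [|n]; first by rewrite (leq_trans _ (leq_addl _ _)) // leq_expl.
by rewrite (leq_trans _ (leq_addr _ _)) // -expnMn leq_expl //; nia.
Qed.

(** With [d = n %/ c.+1] the bound is at most [D * d ^ c], which is below [d ^ (c + 1)] for [d > D],
    and [d < 2 ^ d] turns this into [2 ^ n]. *)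
Lemma polyb_le_exp2 F : polyb F -> exists n0, forall n, n0 <= n -> F n <= expn 2 n.
Proof.
move=> [c hc]; set D := expn (3 * c.+1) c.
exists (D.+1 * c.+1) => n le; apply: leq_trans (hc n) _.
set d := n %/ c.+1.
have Dd : D < d by rewrite leq_divRL.
have nd : n < d.+1 * c.+1 by rewrite -ltn_divLR.
(* [n + c.+1] is at most [(d + 2) * c.+1], and [d] is positive. *)
apply: (@leq_trans (expn (3 * c.+1 * d) c)); first by apply: leq_expl; nia.
rewrite expnMn; apply: (@leq_trans (expn d c.+1)).
  by rewrite expnS leq_mul2r (ltnW Dd) orbT.
apply: (@leq_trans (expn (expn 2 d) c.+1)).
  by apply: leq_expl; apply: ltnW; apply: ltn_expl.
by rewrite -expnM leq_exp2l // leq_trunc_div.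
Qed.

(** * The good pair and the reduction *)

(* The instance of [z] after [i] of its bits have been filled in; cell 29 of a block is
   the track of [z] and cell 28 marks the slots still to be filled. *)
Definition filling (x y z : seq bool) (tL tB Ns i : nat) : seq bool :=
  mkseq (fun p => if p %% 44 == 28 then (i <= p %/ 44) && (p %/ 44 < size z)
    else if p %% 44 == 29 then (p %/ 44 < i) && nth false z (p %/ 44)
    else layout (instance_bits x y (nseq (size z) false) tL tB) p) (44 * Ns).-1.

(** This is what makes the initial filling an advice: it depends on [z] through its length only. *)
Lemma filling_start x y z z' tL tB Ns : size z = size z' ->
  filling x y z tL tB Ns 0 = filling x y z' tL tB Ns 0.
Proof. by move=> e; rewrite /filling e. Qed.

Lemma filling_end x y z tL tB Ns :
  filling x y z tL tB Ns (size z) = instance x y z tL tB Ns.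
Proof.
apply: eq_mkseq => p; rewrite /layout.
case: eqP => [->|n28] /=; first by rewrite leqNgt andNb.
case: eqP => [->|n29] /=.
  by case: ltnP => // h; rewrite nth_default.
case o : (odd (p %% 44)) => //=; case l : (_ < _) => //=.
(* Track index 14 is 7 * 2 + 0, the bits of [z], the only entries changed when [z] is replaced by
   zeros. *)
have : ((p %% 44)./2 != 14) && ((p %% 44)./2 < 21) by apply/andP; split; [apply/eqP|]; lia.
move: (p %% 44)./2 => k /andP[ne lt].
rewrite /instance_bits /component; case e : (k %% 7) => [|[|[|[|[|?]]]]] //.
  by case d : (k %/ 7) => [|[|r]] //; lia.
by case: (k %/ 7) => [|[|?]] //; rewrite size_nseq.
Qed.

Lemma fill_with_advice (Mf : TM) x y z tL tB Ns T T' : size z < Ns ->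
  halted (cstate (run Mf T (encode (instance x y z tL tB Ns)))) ->
  T + size z * (2 * size z + 2 * (44 * Ns).-1 + 4) + 1 <= T' ->
  let cf := run (filler Mf) T' (encode_pair z (filling x y z tL tB Ns 0)) in
  halted (cstate cf) /\ coutput cf = coutput (run Mf T (encode (instance x y z tL tB Ns))).
Proof.
move=> zN hal le; rewrite -filling_end in hal *.
have pos i : i < size z -> i * 44 + 29 < (44 * Ns).-1 by lia.
apply: (filler_correct (slot := fun i => i * 44 + 28) (S := (44 * Ns).-1)) => //.
- by move=> i; rewrite size_mkseq.
- by move=> i _; lia.
- by move=> i /pos; lia.
- move=> i j /pos iN ji oj; rewrite /filling nth_mkseq; last lia.
  case: eqP => [e|_]; first by apply/negbTE; rewrite negb_and -ltnNge; apply/orP; left; lia.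
  case: eqP => [e|_]; first lia.
  rewrite /layout; case o : (odd (j %% 44)) => //; lia.
- move=> i lt; have iN := pos i lt; rewrite /filling nth_mkseq; last lia.
  by rewrite modnMDl divnMDl //= addn0 leqnn.
- move=> i j lt; have iN := pos i lt.
  case: (ltnP j (44 * Ns).-1) => h; last first.
    have D k : nth false (filling x y z tL tB Ns k) j = false by rewrite nth_default // size_mkseq.
    rewrite !D; by case: eqP => // _; case: eqP => // e; lia.
  rewrite /filling !nth_mkseq //.
  case: eqP => [e28|n28]; first by case: eqP => [e|ne]; [|case: eqP => [e2|ne2]]; lia.
  case: eqP => [e29|n29].
    case: eqP => [e|ne]; first lia.
    case: eqP => [e|ne2].
      have -> : j %/ 44 = i by lia.
      by rewrite leqnn.
    by congr (_ && _); lia.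
  by case: eqP => [e|_]; [lia | case: eqP => [e|_]; [lia|]].
Qed.

Lemma advice_ppoly (f : seq bool -> seq bool) (X Y : nat -> seq bool) (tL tB Ns : nat -> nat) :
  poly_time_computable f -> polyb Ns -> (forall n, n < Ns n) ->
  ppoly_computable (fun z => let n := size z in
    f (instance (X n) (Y n) z (tL n) (tB n) (Ns n))).
Proof.
move=> [Mf [cf [kf hf]]] pN nN.
pose T n := pbound cf kf (44 * Ns n).-1.
(* The sum bounds both the length of the advice and the running time, as [ppoly_computable] has one
   polynomial for both. *)
pose F n := 44 * Ns n + (T n + n * (2 * n + 2 * (44 * Ns n).-1 + 4) + 1).
have pS : polyb (fun n => 44 * Ns n) by apply: polyb_mul pN; apply: polyb_const.
have pS' : polyb (fun n => (44 * Ns n).-1) by apply: polyb_le pS => n; apply: leq_pred.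
have pF : polyb F.
  apply: polyb_add => //; apply: polyb_add; last exact: polyb_const.
  apply: polyb_add; first exact: polyb_pbound.
  apply: polyb_mul; first exact: polyb_id.
  apply: polyb_add; last exact: polyb_const.
  by apply: polyb_add; apply: polyb_mul => //; try exact: polyb_const; exact: polyb_id.
have [c [k hF]] := polyb_le_pbound pF.
exists (filler Mf), c, k, (fun n => filling (X n) (Y n) (nseq n false) (tL n) (tB n) (Ns n) 0).
split=> [n|z].
  by rewrite size_mkseq; apply: leq_trans (hF n); rewrite /F; lia.
lazy beta zeta; set n := size z.
have [h1 h2] := hf (instance (X n) (Y n) z (tL n) (tB n) (Ns n)).
rewrite (@filling_start _ _ _ z); last by rewrite size_nseq.
rewrite size_instance -/(T n) in h1 h2.
rewrite -h2; apply: fill_with_advice => //.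
by apply: leq_trans (hF n); rewrite /F; lia.
Qed.

Lemma instance_projection x y z tL tB Ns m : size x = m -> size y = m ->
  bit_projection m (44 * Ns).-1 (fun u => instance x u z tL tB Ns) /\
  bit_projection m (44 * Ns).-1 (fun u => instance u y z tL tB Ns).
Proof.
move=> sx sy; split; split; try by move=> u _; rewrite size_mkseq.
- move=> p lt; have E u : nth false (instance x u z tL tB Ns) p = layout (instance_bits x u z tL tB) p.
    by rewrite nth_mkseq.
  set j := p %% 44; set i := p %/ 44.
  have [h|h] := boolP [&& odd j, j < 43, j./2 %/ 7 == 0, j./2 %% 7 == 0 & i < m].
    right; exists i; first by case/and5P: h.
    by move=> u su; rewrite E /layout -/j -/i; case/and5P: h => -> -> /eqP -> /eqP ->.
  left; exists (layout (instance_bits x (nseq m false) z tL tB) p) => u su; rewrite E /layout -/j -/i.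
  move: h; case: (odd j) => //=; case: (j < 43) => //=.
  case: (j./2 %/ 7) => [|r]; case: (j./2 %% 7) => [|[|a]] //=.
    by rewrite -leqNgt => le; rewrite !nth_default // ?size_nseq ?su.
  by rewrite su size_nseq.
- move=> p lt; have E u : nth false (instance u y z tL tB Ns) p = layout (instance_bits u y z tL tB) p.
    by rewrite nth_mkseq.
  set j := p %% 44; set i := p %/ 44.
  have [h|h] := boolP [&& odd j, j < 43, j./2 %/ 7 == 1, j./2 %% 7 == 0 & i < m].
    right; exists i; first by case/and5P: h.
    by move=> u su; rewrite E /layout -/j -/i; case/and5P: h => -> -> /eqP -> /eqP ->.
  left; exists (layout (instance_bits (nseq m false) y z tL tB) p) => u su; rewrite E /layout -/j -/i.
  move: h; case: (odd j) => //=; case: (j < 43) => //=.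
  case: (j./2 %/ 7) => [|[|r]]; case: (j./2 %% 7) => [|[|a]] //=.
    by rewrite -leqNgt => le; rewrite !nth_default // ?size_nseq ?su.
  by rewrite su size_nseq.
Qed.

Definition decide (P : Prop) : bool := if excluded_middle_informative P then true else false.

Lemma decideP (P : Prop) : reflect P (decide P).
Proof. by rewrite /decide; case: excluded_middle_informative => h; constructor. Qed.

(** Up to [m.+1] strings of a cover are combined with at most [2 ^ N] strings [z], and each of the
    resulting runs is compared with at most [2 ^ (N + 1)] short strings. *)
Definition pair_circuit_bound (M : TM) (T N m : nat) : nat :=
  hit_cost M T N (expn 2 N.+1) * (m.+1 * expn 2 N) + m.+1 * expn 2 N + 2.

Lemma pair_circuit n N M T m S (ps : seq (seq bool * seq bool)) (inp : seq bool * seq bool -> seq bool -> seq bool)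
    (s : seq (seq bool)) neg :
  (forall u, u \in ps -> bit_projection m S (inp u)) -> n <= N ->
  size s <= expn 2 N.+1 -> all (fun a => size a <= n) s -> size ps <= m.+1 * expn 2 N ->
  exists2 C : circuit, circ_size C <= pair_circuit_bound M T N m &
  forall x, size x = m -> circ_eval C x =
    neg (+) has (fun u => has (fun a => coutput (run M T (encode (inp u x))) == a) s) ps.
Proof.
move=> hp nN ss sa sp.
have [||C le h] := @hit_circuit m S M T N (expn 2 N.+1) (size ps)
   (fun i => inp (nth ([::], [::]) ps i)) (fun=> s) neg.
- by move=> i lt; apply: hp; apply: mem_nth.
- move=> i _; split=> //; apply/allP => a /(allP sa) h; exact: leq_trans h nN.
exists C.
  apply: (leq_trans le); rewrite /pair_circuit_bound leq_add2r; apply: leq_add => //.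
  by rewrite leq_mul2l sp orbT.
move=> x sx; rewrite h //; congr (_ (+) _).
rewrite -[in RHS](mkseq_nth ([::], [::]) ps) has_map; exact: eq_has.
Qed.

(** * Existence of a good pair *)

Section HardPair.
Variables (L A B : language) (f : seq bool -> seq bool) (Mf : TM) (T N n m tL tB Ns : nat).
Notation inst x y z := (instance x y z tL tB Ns).
Hypothesis run_f : forall s, size s = (44 * Ns).-1 -> coutput (run Mf T (encode s)) = f s.
Hypothesis f_reduces : forall x y z, size x = m -> size y = m -> size z = n ->
  (A (f (inst x y z)) <-> L y \/ (L x /\ B z)).
Hypothesis nN : n <= N.
Hypothesis hard : forall C, computes_Ln C L m -> pair_circuit_bound Mf T N m < circ_size C.

Lemma hard_pair : exists xy : seq bool * seq bool,
  [/\ size xy.1 = m, size xy.2 = m, L xy.1, ~ L xy.2 &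
   forall z, size z = n -> n < size (f (inst xy.1 xy.2 z))].
Proof.
apply: NNPP => no.
have bad x y : size x = m -> size y = m -> L x -> ~ L y ->
    exists2 z, size z = n & size (f (inst x y z)) <= n.
  move=> sx sy Lx Ly; apply: NNPP => nz; apply: no; exists (x, y); split => // z sz.
  by rewrite ltnNge; apply/negP => le; apply: nz; exists z.
pose sB b := [seq z <- bit_strings n | decide (B z) == b].
pose sA b := [seq a <- short_strings n | decide (A a) == b].
(* [R false x y] is the certificate that [y] is not in [L]; [R true x y] is the certificate that [x]
   is in [L], valid if [y] is not. *)
pose R b (x y : seq bool) := has (fun z => has (fun a => f (inst x y z) == a) (sA b)) (sB b).
pose sL b := [seq x <- bit_strings m | decide (L x) == b].
have mL b x : (x \in sL b) = (decide (L x) == b) && (size x == m).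
  by rewrite mem_filter mem_bit_strings.
(* The exponent is the size of the cover, hence the factor [m.+1] in the circuit bound. *)
have szL b : size (sL b) < expn 2 m.+1.
  rewrite size_filter (leq_ltn_trans (count_size _ _)) // size_bit_strings ltn_exp2l //.
have RP b x y : reflect (exists2 z, size z = n & [/\ decide (B z) = b, decide (A (f (inst x y z))) = b & size (f (inst x y z)) <= n]) (R b x y).
  apply: (iffP hasP) => [[z]|[z sz [h1 h2 h3]]].
    rewrite mem_filter mem_bit_strings => /andP[/eqP h1 /eqP h2] /hasP[a].
    rewrite mem_filter mem_short_strings => /andP[/eqP h3 h4] /eqP e; exists z => //.
    by rewrite e.
  exists z; first by rewrite mem_filter mem_bit_strings h1 sz !eqxx.
  by apply/hasP; exists (f (inst x y z)) => //; rewrite mem_filter mem_short_strings h2 h3 eqxx.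
have cov x y : x \in sL true -> y \in sL false -> R false x y || R true x y.
  rewrite !mL => /andP[/eqP/decideP Lx /eqP sx] /andP[/eqP nLy /eqP sy].
  have Ly : ~ L y by move=> /decideP; rewrite nLy.
  have [z sz le] := bad x y sx sy Lx Ly; have fr := f_reduces sx sy sz.
  case: (decideP (B z)) => Bz; apply/orP; [right | left]; apply/RP; exists z => //; split => //.
  - exact/decideP.
  - by apply/decideP; rewrite fr; right.
  - exact/negbTE/decideP.
  - by apply/negbTE/decideP; rewrite fr => -[//|[_ //]].
have szA b : size (sA b) <= expn 2 N.+1.
  rewrite size_filter (leq_trans (count_size _ _)) // (leq_trans (size_short_strings n)) //.
  by rewrite leq_exp2l.
have allA b : all (fun a => size a <= n) (sA b).
  by apply/allP => a; rewrite mem_filter mem_short_strings => /andP[].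
have szps b (us : seq (seq bool)) : size us <= m.+1 -> size [seq (u, z) | u <- us, z <- sB b] <= m.+1 * expn 2 N.
  move=> le; rewrite size_allpairs leq_mul // size_filter (leq_trans (count_size _ _)) //.
  by rewrite size_bit_strings leq_exp2l.
have memps b (us : seq (seq bool)) (P : seq bool -> seq bool -> bool) :
   has (fun u => P u.1 u.2) [seq (u, z) | u <- us, z <- sB b] = has (fun u => has (P u) (sB b)) us.
  by elim: us => //= u us IH; rewrite has_cat has_map IH.
have [[xs [szx subx hx]]|[ys [szy suby hy]]] := cover_alternative cov (szL true) (szL false).
- have [|C le hC] := @pair_circuit n N Mf T m (44 * Ns).-1 [seq (x, z) | x <- xs, z <- sB false]
     (fun u v => inst u.1 v u.2) (sA false) true _ nN (szA false) (allA false) (szps _ _ szx).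
    move=> u /allpairsP[[x z] [/= xin _ ->]] /=.
    by move: (subx _ xin); rewrite mL => /andP[_ /eqP sx]; have [] := instance_projection z tL tB Ns sx sx.
  suff cmp : computes_Ln C L m by have := hard cmp; rewrite ltnNge le.
  move=> y sy; rewrite hC //.
  rewrite (eq_has (a2 := fun u => (fun x z => has (fun a => f (inst x y z) == a) (sA false)) u.1 u.2)); last first.
    by move=> u; apply: eq_has => a; rewrite run_f // size_mkseq.
  rewrite (memps _ _ (fun x z => has (fun a => f (inst x y z) == a) (sA false))).
  rewrite -/(R false _ y); split.
    move=> /negP nh; apply: NNPP => Ly; apply: nh; apply: hx.
    by rewrite mL sy eqxx andbT; apply/eqP/negbTE/decideP.
  move=> Ly; apply/negP => /hasP[x xin /RP[z sz [h1 h2 h3]]].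
  move: (subx _ xin); rewrite mL => /andP[_ /eqP sx].
  by move/negbT/decideP: h2; apply; rewrite f_reduces //; left.
- have [|C le hC] := @pair_circuit n N Mf T m (44 * Ns).-1 [seq (y, z) | y <- ys, z <- sB true]
     (fun u v => inst v u.1 u.2) (sA true) false _ nN (szA true) (allA true) (szps _ _ szy).
    move=> u /allpairsP[[y z] [/= yin _ ->]] /=.
    by move: (suby _ yin); rewrite mL => /andP[_ /eqP sy]; have [] := instance_projection z tL tB Ns sy sy.
  suff cmp : computes_Ln C L m by have := hard cmp; rewrite ltnNge le.
  move=> x sx; rewrite hC //.
  rewrite (eq_has (a2 := fun u => (fun y z => has (fun a => f (inst x y z) == a) (sA true)) u.1 u.2)); last first.
    by move=> u; apply: eq_has => a; rewrite run_f // size_mkseq.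
  rewrite (memps _ _ (fun y z => has (fun a => f (inst x y z) == a) (sA true))).
  rewrite -/(R true x _) addFb; split; last first.
    by move=> Lx; apply: hy; rewrite mL sx eqxx andbT; apply/eqP/decideP.
  move=> /hasP[y yin /RP[z sz [h1 h2 h3]]].
  move: (suby _ yin); rewrite mL => /andP[/eqP nLy /eqP sy].
  have Ly : ~ L y by move=> /decideP; rewrite nLy.
  by move/decideP: h2; rewrite f_reduces // => -[//|[]].
Qed.

End HardPair.

(** The tables contribute [2 ^ (2 * N + 1)] and the polynomial factors at most [2 ^ N]; the total
    exponent [3 * N + 1] is at most [N * N] from [N = 4] on. *)
Lemma pair_circuit_bound_exp2 M (T m : nat -> nat) : polyb T -> polyb m ->
  exists n0, forall N, n0 <= N -> pair_circuit_bound M (T N) N (m N) <= expn 2 (N * N).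
Proof.
move=> pT pm.
have [n0 h0] : exists n0, forall n, n0 <= n -> (m n).+1 * (hit_cost M (T n) n 1 + 3) <= expn 2 n.
  apply: polyb_le_exp2.
  have K a := polyb_const a.
  have Sc F : polyb F -> polyb (fun n => (F n).+1).
    by move=> h; apply: polyb_le (polyb_add h (K 1)) => n; rewrite addn1.
  apply: polyb_mul; first exact: Sc.
  apply: polyb_add => //; apply: polyb_add => //; apply: polyb_add.
    apply: polyb_mul; first exact: Sc.
    apply: polyb_mul => //; apply: polyb_mul => //.
    apply: polyb_add => //; apply: polyb_add; last exact: polyb_id.
    exact: polyb_mul.
  apply: polyb_mul.
    by apply: polyb_add => //; apply: polyb_add => //; exact: polyb_id.
  by apply: polyb_mul => //; apply: Sc; apply: polyb_mul.
exists (n0 + 4) => N le.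
have hN := h0 N (leq_trans (leq_addr _ _) le).
set E := expn 2 N.+1; set D := (m N).+1 * expn 2 N.
have E0 : 0 < E by rewrite expn_gt0.
have hc : hit_cost M (T N) N E <= E * hit_cost M (T N) N 1.
  rewrite /hit_cost; move: (_ * (update_cost M * _)) (_ + N + 6) (2 * T N).+1 => a b d.
  by rewrite muln1; nia.
have D0 : 0 < D by rewrite muln_gt0 expn_gt0.
apply: (@leq_trans (E * expn 2 N * ((m N).+1 * (hit_cost M (T N) N 1 + 3)))).
  rewrite /pair_circuit_bound -/E -/D.
  have -> : E * expn 2 N * ((m N).+1 * (hit_cost M (T N) N 1 + 3)) = E * hit_cost M (T N) N 1 * D + 3 * (E * D).
    by rewrite /D; move: (E) (expn _ _) (m N).+1 (hit_cost _ _ _ _) => *; lia.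
  rewrite -addnA leq_add //; first by rewrite leq_mul2r hc orbT.
  have := leq_pmull D E0; have := leq_pmulr E D0; lia.
apply: (leq_trans (leq_mul (leqnn _) hN)); rewrite /E -!expnD leq_exp2l //.
have : 4 * N <= N * N by rewrite leq_mul2r; apply/orP; right; lia.
by lia.
Qed.

Lemma INR_expn a b : INR (expn a b) = (INR a ^ b)%R.
Proof. by elim: b => [|b IH] //; rewrite expnS -[muln _ _]/(Nat.mul _ _) mult_INR IH. Qed.

(** [(N ^ K) ^ eps = N ^ (K * eps)] is at least [N ^ 2]. *)
Lemma exp2_square_le_Rpower (eps : R) (K N : nat) : 1 <= N -> (2 <= INR K * eps)%R ->
  (INR (expn 2 (N * N)) <= Rpower 2 (Rpower (INR (expn N K)) eps))%R.
Proof.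
move=> N1 hK.
have N1R : (1 <= INR N)%R by apply: (le_INR 1); apply/leP.
rewrite !INR_expn -[INR 2]/2%R.
rewrite -(Rpower_pow (N * N)); last lra.
rewrite -(Rpower_pow K); last lra.
rewrite Rpower_mult; apply: Rle_Rpower; first lra.
apply: (Rle_trans _ (Rpower (INR N) 2)); last by apply: Rle_Rpower => //; lra.
rewrite -[muln _ _]/(Nat.mul _ _) mult_INR -[2%R]/(INR 2) Rpower_pow /=; lra.
Qed.

Theorem theorem3p1 (L : language) (eps : R) :
  in_NP L -> (0 < eps)%R ->
  (exists n0 : nat, forall n : nat, n0 <= n ->
     CC_gt L n (Rpower 2 (Rpower (INR n) eps))) ->
  forall A : language, NP_complete A ->
  forall B : language, in_NP B ->
  exists f : seq bool -> seq bool,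
    ppoly_computable f /\
    (forall x, B x <-> A (f x)) /\
    (forall x, size x < size (f x)).
Proof.
move=> [ML [cL [kL hL]]] eps0 [n0 hard] A [_ Acomplete] B [MB [cB [kB hB]]].
have [f [fpoly fS]] := Acomplete _ (verified_NP ML MB).
have [Mf [cf [kf hf]]] := fpoly.
have [K hK] := INR_archimed eps 2 eps0.
have K0 : 0 < K by case: K hK => //=; lra.
pose m N := expn N K; pose tL N := pbound cL kL (m N).
(* The successor of the sum of all lengths and clocks satisfies every strict bound required of an
   instance. *)
pose Ns N := (m N + N + tL N + pbound cB kB N).+1.
pose T N := pbound cf kf (44 * Ns N).-1.
have pm : polyb m by apply: polyb_pow; apply: polyb_id.
have pN : polyb Ns.
  apply: polyb_le (polyb_add (polyb_add (polyb_add (polyb_add pm polyb_id)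
    (polyb_pbound cL kL pm)) (polyb_pbound cB kB polyb_id)) (polyb_const 1)) => n.
  by rewrite addn1.
have pT : polyb T.
  apply: polyb_pbound; apply: polyb_le (polyb_mul (polyb_const 44) pN) => n; exact: leq_pred.
have [n1 hn1] := pair_circuit_bound_exp2 Mf pT pm.
(* With [N = n + n2], both the hardness of [L] at length [m N] and the estimate of the circuit size
   hold for every [n], and [N] is positive. *)
pose n2 := n0 + n1 + 1.
have mono c k a b : a <= b -> pbound c k a <= pbound c k b.
  by move=> le; rewrite !pboundE leq_add2r leq_mul2l leq_expl ?orbT.
have spec n x y z : size x = m (n + n2) -> size y = m (n + n2) -> size z = n ->
    A (f (instance x y z (tL (n + n2)) (pbound cB kB n) (Ns (n + n2)))) <-> L y \/ (L x /\ B z).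
  move=> sx sy sz.
  (* The clock for [B] is set for the true length [n] of [z], whereas the block count is computed
     from [n + n2]. *)
  have hb : pbound cB kB n <= pbound cB kB (n + n2) by apply: mono; apply: leq_addr.
  rewrite -fS verified_instance; try by rewrite /Ns ?sx ?sy ?sz /tL; lia.
  by rewrite (hL x) (hL y) (hB z) sx sy sz.
have pair n : exists xy : seq bool * seq bool,
  [/\ size xy.1 = m (n + n2), size xy.2 = m (n + n2), L xy.1, ~ L xy.2 &
   forall z, size z = n ->
     n < size (f (instance xy.1 xy.2 z (tL (n + n2)) (pbound cB kB n) (Ns (n + n2))))].
  apply: (@hard_pair L A B f Mf (T (n + n2)) (n + n2)).
  - by move=> s ss; rewrite /T -ss; case: (hf s).
  - exact: spec.
  - exact: leq_addr.
  - move=> C hC; have N1 : 1 <= n + n2 by rewrite /n2; lia.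
    have mN : n0 <= m (n + n2).
      rewrite /m (@leq_trans (expn (n + n2) 1)) ?leq_pexp2l // expn1 /n2; lia.
    have cc := hard _ mN C hC.
    have b1 : pair_circuit_bound Mf (T (n + n2)) (n + n2) (m (n + n2)) <= expn 2 ((n + n2) * (n + n2)).
      by apply: hn1; rewrite /n2; lia.
    have b2 := @exp2_square_le_Rpower eps K (n + n2) N1 (Rlt_le _ _ hK).
    apply/leP; apply: INR_lt; apply: Rle_lt_trans (Rle_lt_trans _ _ _ b2 cc).
    by apply: le_INR; apply/leP.
(* The pair is merely known to exist, and it depends only on [n]: this is the nonuniform part of the
   reduction. *)
pose xy n := proj1_sig (constructive_indefinite_description _ (pair n)).
have xyP n := proj2_sig (constructive_indefinite_description _ (pair n)).
exists (fun z => let n := size z in f (instance (xy n).1 (xy n).2 z (tL (n + n2)) (pbound cB kB n) (Ns (n + n2)))).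
split; [|split].
- apply: (@advice_ppoly f (fun n => (xy n).1) (fun n => (xy n).2) (fun n => tL (n + n2))
    (pbound cB kB) (fun n => Ns (n + n2))) => //.
    exact: polyb_shift.
  by move=> n; rewrite /Ns; lia.
- move=> z; have [s1 s2 L1 L2 _] := xyP (size z).
  rewrite spec //; split=> [Bz|[//|[]//]]; by right.
- by move=> z; have [_ _ _ _ h] := xyP (size z); apply: h.
Qed.
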